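(* Let $F$ be a subfield of $\mathbb{R}$. If $\hat s$ and $\hat t$ are terms in normal form and $T[F]$ proves $\hat s=\hat t$, then $\hat s$ and $\hat t$ are syntactically identical.
   Context: For $a\in F$, $f_a(x)=ax$. $T_{\mathrm{add}}[F]$ is the set of sentences true in $(\mathbb{R},0,1,+,-,<,(f_a)_{a\in F})$, $T_{\mathrm{mult}}[F]$ the set of sentences true in $(\mathbb{R},0,1,\times,\div,<,(f_a)_{a\in F})$ with $x\div0=0$, and $T[F]=T_{\mathrm{add}}[F]\cup T_{\mathrm{mult}}[F]$; an equation with free variables is provable if its universal closure is. We write $at$ for $f_a(t)$. Variables are indexed $x_1,x_2,\ldots$. Preterms and their ranks: rank $0$ (basic) preterms are the variables and the constant $1$. For odd $n>0$, the additive preterms of rank $n$ are $a_1t_1+\cdots+a_kt_k$ (parenthesized to the left) with $k\ge2$, $a_i\in F\setminus\{0\}$, each $t_i$ a multiplicative or basic preterm of rank $\le n-1$, and some $t_i$ of rank $n-1$. For even $n>0$, the multiplicative preterms of rank $n$ are $t_1^{i_1}\cdots t_k^{i_k}$ (left-parenthesized) with each $t_j$ an additive or basic preterm of rank $\le n-1$ other than $1$, the $i_j$ nonzero integers, $k\ge2$ or $i_1\ne1$, and some $t_j$ of rank at least $n-2$; here $t^i$ is the $i$-fold product of $t$ if $i>0$ and $1\div(t^{-i})$ if $i<0$. Normal form and a strict order $\prec$ on normal-form preterms are defined simultaneously by induction on rank. Rank $0$: all basic preterms are in normal form, ordered $1\succ x_1\succ x_2\succ\cdots$. Odd $n$: $a_1t_1+\cdots+a_kt_k$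 is in normal form iff every $t_i$ is, $t_1\succ t_2\succ\cdots\succ t_k$, and $a_1=1$; to compare $s,t$ of rank $\le n$ with at least one of rank $n$, write $s=\sum_i a_iu_i$, $t=\sum_i b_iu_i$ over the common list $u_1\succ\cdots\succ u_k$ of preterms of rank $\le n-1$ (coefficients now allowed to be $0$; a non-additive preterm $u$ is $1\cdot u$), and set $s\prec t$ iff $a_i\ne b_i$ for some $i$ and $a_i<b_i$ for the least such $i$. Even $n$: $t_1^{i_1}\cdots t_k^{i_k}$ is in normal form iff each $t_j$ is and $t_1\succ\cdots\succ t_k$; to compare $s,t$ of rank $\le n$, list the subterms of both, together with $1$, in $\succ$-decreasing order $u_1,\ldots,u_m,1,u_{m+1},\ldots,u_k$ and write $s=u_1^{i_1}\cdots u_m^{i_m}\cdot1\cdot u_{m+1}^{i_{m+1}}\cdots u_k^{i_k}$, $t=u_1^{j_1}\cdots u_m^{j_m}\cdot1\cdot u_{m+1}^{j_{m+1}}\cdots u_k^{j_k}$ (exponents may be $0$); then $s\prec t$ iff either there is $l\le m$ with $i_l\ne j_l$ and $i_l<j_l$ for the least such $l$, or $i_l=j_l$ for all $l\le m$ but there is $l>m$ with $i_l\ne j_l$ and $i_l>j_l$ for the largest such $l$. A term is in normal form if it is $0$ or of the form $at$ with $t$ a preterm in normal form and $a\in F\setminus\{0\}$. *)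

(* Defs.v *)
From Stdlib Require Import Reals ZArith List Arith Bool.
Open Scope bool_scope.
Import ListNotations.
Open Scope R_scope.

(** * The language: 0, 1, +, -, *, ÷, <, and unary f_a (a : R; only a ∈ F used) *)

Inductive term : Type :=
  | Var  : nat -> term                 (* Var n is the variable x_(n+1) *)
  | Zero : term
  | One  : term
  | Add  : term -> term -> term
  | Sub  : term -> term -> term
  | Mul  : term -> term -> term
  | Div  : term -> term -> term
  | Scal : R -> term -> term.

Inductive formula : Type :=
  | FEq  : term -> term -> formula
  | FLt  : term -> term -> formula
  | FBot : formula
  | FImp : formula -> formula -> formula
  | FAnd : formula -> formula -> formula
  | FOr  : formula -> formula -> formula
  | FAll : nat -> formula -> formula
  | FEx  : nat -> formula -> formula.

Record is_subfield (F : R -> Prop) : Prop := {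
  sf0 : F 0; sf1 : F 1;
  sfadd : forall x y, F x -> F y -> F (x + y);
  sfopp : forall x, F x -> F (- x);
  sfmul : forall x y, F x -> F y -> F (x * y);
  sfinv : forall x, F x -> x <> 0 -> F (/ x) }.

Fixpoint add_term (F : R -> Prop) (t : term) : Prop :=
  match t with
  | Var _ | Zero | One => True
  | Add u v | Sub u v => add_term F u /\ add_term F v
  | Mul _ _ | Div _ _ => False
  | Scal a u => F a /\ add_term F u
  end.

Fixpoint mult_term (F : R -> Prop) (t : term) : Prop :=
  match t with
  | Var _ | Zero | One => True
  | Mul u v | Div u v => mult_term F u /\ mult_term F v
  | Add _ _ | Sub _ _ => False
  | Scal a u => F a /\ mult_term F u
  end.

Fixpoint formula_in (P : term -> Prop) (f : formula) : Prop :=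
  match f with
  | FEq u v | FLt u v => P u /\ P v
  | FBot => True
  | FImp g h | FAnd g h | FOr g h => formula_in P g /\ formula_in P h
  | FAll _ g | FEx _ g => formula_in P g
  end.

Fixpoint occurs_t (x : nat) (t : term) : Prop :=
  match t with
  | Var y => x = y
  | Zero | One => False
  | Add u v | Sub u v | Mul u v | Div u v => occurs_t x u \/ occurs_t x v
  | Scal _ u => occurs_t x u
  end.

Fixpoint occurs_free (x : nat) (f : formula) : Prop :=
  match f with
  | FEq u v | FLt u v => occurs_t x u \/ occurs_t x v
  | FBot => False
  | FImp g h | FAnd g h | FOr g h => occurs_free x g \/ occurs_free x h
  | FAll y g | FEx y g => x <> y /\ occurs_free x g
  end.

Definition sentence (f : formula) : Prop := forall x, ~ occurs_free x f.

Record structure : Type := {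
  carrier : Type;
  s_zero : carrier;
  s_one  : carrier;
  s_add  : carrier -> carrier -> carrier;
  s_sub  : carrier -> carrier -> carrier;
  s_mul  : carrier -> carrier -> carrier;
  s_div  : carrier -> carrier -> carrier;
  s_lt   : carrier -> carrier -> Prop;
  s_scal : R -> carrier -> carrier }.

Fixpoint eval (M : structure) (env : nat -> carrier M) (t : term) : carrier M :=
  match t with
  | Var n => env n
  | Zero => s_zero M
  | One => s_one M
  | Add u v => s_add M (eval M env u) (eval M env v)
  | Sub u v => s_sub M (eval M env u) (eval M env v)
  | Mul u v => s_mul M (eval M env u) (eval M env v)
  | Div u v => s_div M (eval M env u) (eval M env v)
  | Scal a u => s_scal M a (eval M env u)
  end.

Definition upd {A : Type} (env : nat -> A) (y : nat) (d : A) : nat -> A :=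
  fun z => if Nat.eqb z y then d else env z.

Fixpoint sat (M : structure) (env : nat -> carrier M) (f : formula) : Prop :=
  match f with
  | FEq u v => eval M env u = eval M env v
  | FLt u v => s_lt M (eval M env u) (eval M env v)
  | FBot => False
  | FImp g h => sat M env g -> sat M env h
  | FAnd g h => sat M env g /\ sat M env h
  | FOr g h => sat M env g \/ sat M env h
  | FAll y g => forall d, sat M (upd env y d) g
  | FEx y g => exists d, sat M (upd env y d) g
  end.

Definition div0 (x y : R) : R :=
  if Req_EM_T y 0 then 0 else x / y.

Definition Rstruct : structure :=
  {| carrier := R; s_zero := 0; s_one := 1; s_add := Rplus; s_sub := Rminus;
     s_mul := Rmult; s_div := div0; s_lt := Rlt; s_scal := Rmult |}.

Definition true_in_R (f : formula) : Prop := forall env, sat Rstruct env f.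

Definition T_add (F : R -> Prop) (f : formula) : Prop :=
  sentence f /\ formula_in (add_term F) f /\ true_in_R f.

Definition T_mult (F : R -> Prop) (f : formula) : Prop :=
  sentence f /\ formula_in (mult_term F) f /\ true_in_R f.

Definition T_F (F : R -> Prop) (f : formula) : Prop := T_add F f \/ T_mult F f.

Definition is_model (F : R -> Prop) (M : structure) : Prop :=
  forall f, T_F F f -> forall env, sat M env f.

(** T[F] proves f (f possibly open: its universal closure is meant).
    Rendered as semantic consequence (equivalent to provability by
    Goedel's completeness theorem): the universal closure of f holds in
    every model of T[F]. *)
Definition T_proves (F : R -> Prop) (f : formula) : Prop :=
  forall M : structure, is_model F M -> forall env, sat M env f.

Inductive pre : Type :=
  | PVar : nat -> pre                  (* the variable x_(n+1) *)
  | POne : pre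
  | PAdd : list (R * pre) -> pre       (* a1 t1 + ... + ak tk *)
  | PMul : list (pre * Z) -> pre.      (* t1^i1 ... tk^ik *)

Fixpoint pos_pow (u : term) (k : nat) : term :=
  match k with
  | O => One
  | S O => u
  | S k' => Mul (pos_pow u k') u
  end.

Definition zpow (u : term) (i : Z) : term :=
  match i with
  | Zpos p => pos_pow u (Pos.to_nat p)
  | Zneg p => Div One (pos_pow u (Pos.to_nat p))
  | Z0 => One
  end.

Fixpoint to_term (p : pre) : term :=
  match p with
  | PVar n => Var n
  | POne => One
  | PAdd l =>
      match l with
      | [] => Zero
      | (a, u) :: r =>
          (fix go (acc : term) (r : list (R * pre)) : term :=
             match r with
             | [] => acc
             | (b, v) :: r' => go (Add acc (Scal b (to_term v))) r'
             end) (Scal a (to_term u)) r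
      end
  | PMul l =>
      match l with
      | [] => One
      | (u, i) :: r =>
          (fix go (acc : term) (r : list (pre * Z)) : term :=
             match r with
             | [] => acc
             | (v, j) :: r' => go (Mul acc (zpow (to_term v) j)) r'
             end) (zpow (to_term u) i) r
      end
  end.

Fixpoint maxl (l : list nat) : nat :=
  match l with [] => 0%nat | x :: r => Nat.max x (maxl r) end.

Fixpoint rank (p : pre) : nat :=
  match p with
  | PVar _ | POne => 0%nat
  | PAdd l => S (maxl ((fix rs (l : list (R * pre)) : list nat :=
                         match l with [] => [] | (_, u) :: r => rank u :: rs r end) l))
  | PMul l =>
      let m := maxl ((fix rs (l : list (pre * Z)) : list nat :=
                        match l with [] => [] | (u, _) :: r => rank u :: rs r end) l) in
      if Nat.eqb m 0 then 2%nat else S m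
  end.

Definition base_lt (s t : pre) : Prop :=
  match s, t with
  | PVar i, PVar j => (j < i)%nat
  | PVar _, POne => True
  | _, _ => False
  end.

Definition addcomps (p : pre) : list (R * pre) :=
  match p with PAdd l => l | _ => [(1, p)] end.

Definition mulfacs (p : pre) : list (pre * Z) :=
  match p with PMul l => l | POne => [] | _ => [(p, 1%Z)] end.

Definition hascoef (l : list (R * pre)) (u : pre) (a : R) : Prop :=
  In (a, u) l \/ (a = 0 /\ forall b, ~ In (b, u) l).

Definition hasexp (l : list (pre * Z)) (u : pre) (i : Z) : Prop :=
  In (u, i) l \/ (i = 0%Z /\ forall j, ~ In (u, j) l).

Definition add_lt (ltp : pre -> pre -> Prop) (ls lt : list (R * pre)) : Prop :=
  exists u a b, hascoef ls u a /\ hascoef lt u b /\ a < b /\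
    forall v, ltp u v -> forall a' b', hascoef ls v a' -> hascoef lt v b' -> a' = b'.

Definition mul_lt (ltp : pre -> pre -> Prop) (ls lt : list (pre * Z)) : Prop :=
  (exists u i j, ltp POne u /\ hasexp ls u i /\ hasexp lt u j /\ (i < j)%Z /\
     forall v, ltp u v -> forall i' j', hasexp ls v i' -> hasexp lt v j' -> i' = j')
  \/
  ((forall v, ltp POne v -> forall i' j', hasexp ls v i' -> hasexp lt v j' -> i' = j') /\
   exists u i j, ltp u POne /\ hasexp ls u i /\ hasexp lt u j /\ (j < i)%Z /\
     forall v, ltp v u -> forall i' j', hasexp ls v i' -> hasexp lt v j' -> i' = j').

Fixpoint ltn (n : nat) (s t : pre) : Prop :=
  match n with
  | O => base_lt s t
  | S n' =>
      if Nat.leb (rank s) n' && Nat.leb (rank t) n' then ltn n' s t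
      else if Nat.leb (rank s) n && Nat.leb (rank t) n then
        (if Nat.odd n then add_lt (ltn n') (addcomps s) (addcomps t)
         else mul_lt (ltn n') (mulfacs s) (mulfacs t))
      else False
  end.

Definition prec (s t : pre) : Prop := ltn (Nat.max (rank s) (rank t)) s t.

Fixpoint decreasing (l : list pre) : Prop :=
  match l with
  | x :: ((y :: _) as r) => prec y x /\ decreasing r
  | _ => True
  end.

Definition not_additive (p : pre) : Prop :=
  match p with PAdd _ => False | _ => True end.
Definition not_multiplicative (p : pre) : Prop :=
  match p with PMul _ => False | _ => True end.
Definition not_one (p : pre) : Prop :=
  match p with POne => False | _ => True end.

(** Preterms in normal form (this includes being a well-formed preterm). *)
Fixpoint nf_pre (F : R -> Prop) (p : pre) : Prop :=
  match p with
  | PVar _ | POne => True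
  | PAdd l =>
      (2 <= length l)%nat /\
      (forall a u, In (a, u) l -> F a /\ a <> 0 /\ not_additive u) /\
      (fix all_nf (l : list (R * pre)) : Prop :=
         match l with [] => True | (_, u) :: r => nf_pre F u /\ all_nf r end) l /\
      decreasing (map snd l) /\
      (match l with (a, _) :: _ => a = 1 | [] => False end)
  | PMul l =>
      ((2 <= length l)%nat \/ exists u i, l = [(u, i)] /\ i <> 1%Z) /\
      (forall u i, In (u, i) l -> i <> 0%Z /\ not_multiplicative u /\ not_one u) /\
      (fix all_nf (l : list (pre * Z)) : Prop :=
         match l with [] => True | (u, _) :: r => nf_pre F u /\ all_nf r end) l /\
      decreasing (map fst l)
  end.

Definition nf_term (F : R -> Prop) (t : term) : Prop :=
  t = Zero \/ exists a p, F a /\ a <> 0 /\ nf_pre F p /\ t = Scal a (to_term p).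

(* Main.v *)
(** Encode the elements of a model as finitely supported functions [w : R -> R],
    ordered lexicographically (the sign is read at the largest point of the support),
    with pointwise addition, and define a multiplication through an order isomorphism
    [E], turning real translations into real dilations, from another ordered real vector
    space, that of the logarithms, onto the positive elements. Each such structure is
    a model of T[F], because by Fourier-Motzkin elimination all ordered real vector
    spaces with a distinguished positive element satisfy the same sentences, and so do
    the multiplicative structures obtained from them by exponentiation. Addition and
    multiplication are linked by [E] only, and [E] can be moved near any prescribed
    point without disturbing finitely many others. Treating the subterms of two normal
    forms one at a time, one can thus keep the values of the non-additive ones linearly
    independent, and the logarithms of the values of the non-multiplicative ones
    independent as well; then distinct normal preterms have values that are not even
    proportional.

    The order of normal forms is not transitive as a whole (for s = x1 + x2 and
    r = x1 + x2 + x2^2 one has s < r < s^2 < s). It is, however, a strict total order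
    on the non-additive normal preterms, and on the non-multiplicative ones, which are
    the only ones that are ever sorted together. *)

Require Import Defs.
From Stdlib Require Import Reals ZArith List Sorted Lra Lia.
From Stdlib Require Import Classical ClassicalEpsilon FunctionalExtensionality ProofIrrelevance.
Import ListNotations Defs.
Open Scope R_scope.

(** * Ordered real vector spaces *)

(** No axiom of T[F] mixes sum and product, so [E] need not respect them in any way: the two
    structures share only 0, 1, the order and the scalings. The remaining rigidity is that
    logarithms differing by a real multiple of [vone] must have proportional values. The obstacle is
    that the summands force the value of a sum, and the factors force the logarithm of a product.
    Hence [E] is changed so that a product receives a new value at its given logarithm, and a sum
    receives a new logarithm for its given value. Either change requires the logarithm involved to
    be new modulo real multiples of [vone]. If it were old, the independence reached so far would
    identify the subterm with an earlier one, because a sorted list of nonzero coefficients,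
    normalized as in a normal form, is determined by its coefficient function. Functions on the
    whole line are used because a fresh coordinate exists below any finitely many supports, and
    because a half-line is a copy of the line: what follows a leading term can again be described by
    a function on the line. *)

Record ovs : Type := Ovs {
  vec :> Type;
  idx : Type;
  co : vec -> idx -> R;
  co_inj : forall x y, (forall i, co x i = co y i) -> x = y;
  vadd : vec -> vec -> vec;
  co_add : forall x y i, co (vadd x y) i = co x i + co y i;
  vscal : R -> vec -> vec;
  co_scal : forall a x i, co (vscal a x) i = a * co x i;
  vzero : vec;
  co_zero : forall i, co vzero i = 0;
  vone : vec;
  vpos : vec -> Prop;
  pos_add : forall x y, vpos x -> vpos y -> vpos (vadd x y);
  pos_scal : forall a x, 0 < a -> vpos x -> vpos (vscal a x);
  pos_zero : ~ vpos vzero;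
  pos_total : forall x, x = vzero \/ vpos x \/ vpos (vscal (-1) x);
  pos_one : vpos vone }.

Arguments co {o} _ _.
Arguments vadd {o} _ _.
Arguments vscal {o} _ _.
Arguments vzero {o}.
Arguments vone {o}.
Arguments vpos {o} _.

Definition vsub {X : ovs} (x y : X) : X := vadd x (vscal (-1) y).
Definition vlt {X : ovs} (x y : X) : Prop := vpos (vsub y x).

(** Injective real coordinates take the place of the vector space axioms: a linear identity holds
    once it holds in each coordinate, where [ring] or [field] decides it. *)
Ltac vec_eq :=
  apply co_inj; intro; unfold vsub;
  repeat first [rewrite co_add | rewrite co_scal | rewrite co_zero];
  try (ring || (field; lra)).

Lemma vadd_zero_r (X : ovs) (x : X) : vadd x vzero = x.
Proof. vec_eq. Qed.

Lemma vadd_assoc (X : ovs) (x y z : X) : vadd (vadd x y) z = vadd x (vadd y z).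
Proof. vec_eq. Qed.

Lemma pos_neg (X : ovs) (x : X) : vpos (vscal (-1) x) <-> ~ vpos x /\ x <> vzero.
Proof.
  split.
  - intro H; split; intro H'.
    + apply (pos_zero X). replace (@vzero X) with (vadd x (vscal (-1) x)) by vec_eq.
      now apply pos_add.
    + subst x. apply (pos_zero X). replace (@vzero X) with (vscal (-1) (@vzero X)) by vec_eq.
      exact H.
  - intros [H1 H2]. destruct (pos_total X x) as [H|[H|H]]; tauto.
Qed.

Lemma vlt_total (X : ovs) (x y : X) : x = y \/ vlt x y \/ vlt y x.
Proof.
  unfold vlt. destruct (pos_total X (vsub y x)) as [H|[H|H]].
  - left. replace y with (vadd (vsub y x) x) by vec_eq. rewrite H. vec_eq.
  - tauto.
  - right; right. replace (vsub x y) with (vscal (-1) (vsub y x)) by vec_eq. exact H.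
Qed.

Lemma vlt_irr (X : ovs) (x : X) : ~ vlt x x.
Proof.
  unfold vlt. replace (vsub x x) with (@vzero X) by vec_eq. apply pos_zero.
Qed.

Lemma vlt_trans (X : ovs) (x y z : X) : vlt x y -> vlt y z -> vlt x z.
Proof.
  unfold vlt; intros H1 H2. replace (vsub z x) with (vadd (vsub y x) (vsub z y)) by vec_eq.
  now apply pos_add.
Qed.

Lemma vlt_add (X : ovs) (x y z : X) : vlt x y <-> vlt (vadd x z) (vadd y z).
Proof. unfold vlt. replace (vsub (vadd y z) (vadd x z)) with (vsub y x) by vec_eq. tauto. Qed.

Lemma vsub_zero (X : ovs) (x y : X) : vsub x y = vzero <-> x = y.
Proof.
  split; intro H.
  - replace x with (vadd (vsub x y) y) by vec_eq. rewrite H. vec_eq.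
  - subst. vec_eq.
Qed.

(** Midpoints make the order dense and [vone] makes it unbounded on both sides; finitely many bounds
    reduce to the greatest of the lower and the least of the upper ones. *)
Lemma vlt_between (X : ovs) (lo up : list X) :
  (forall x y, In x lo -> In y up -> vlt x y) ->
  exists d, (forall x, In x lo -> vlt x d) /\ (forall y, In y up -> vlt d y).
Proof.
  assert (Hmax : forall l : list X, l <> [] ->
            exists m, In m l /\ forall x, In x l -> x = m \/ vlt x m).
  { induction l as [|a l IH]; [congruence|]. intros _.
    destruct l as [|b l].
    - exists a; split; [now left|]. intros x [->|[]]; now left.
    - destruct IH as [m [Hm1 Hm2]]; [congruence|].
      destruct (vlt_total X a m) as [->|[H|H]].
      + exists m; split; [now left|]. intros x [->|Hx]; auto.
      + exists m; split; [now right|]. intros x [->|Hx]; auto.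
      + exists a; split; [now left|]. intros x [->|Hx]; [now left|]. right.
        destruct (Hm2 _ Hx) as [->|Hx']; auto. eapply vlt_trans; eassumption. }
  assert (Hmin : forall l : list X, l <> [] ->
            exists m, In m l /\ forall x, In x l -> x = m \/ vlt m x).
  { intros l Hl. destruct (Hmax (map (vscal (-1)) l)) as [m [Hm1 Hm2]].
    - destruct l; simpl; congruence.
    - apply in_map_iff in Hm1. destruct Hm1 as [m' [<- Hm']].
      exists m'; split; auto. intros x Hx.
      destruct (Hm2 _ (in_map (vscal (-1)) _ _ Hx)) as [H|H].
      + left. replace x with (vscal (-1) (vscal (-1) x)) by vec_eq. rewrite H. vec_eq.
      + right. unfold vlt in *.
        now replace (vsub x m') with (vsub (vscal (-1) m') (vscal (-1) x)) by vec_eq. }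
  assert (H1 : forall x : X, vlt x (vadd x vone)).
  { intro x. unfold vlt. replace (vsub (vadd x vone) x) with (@vone X) by vec_eq. apply pos_one. }
  assert (H2 : forall x : X, vlt (vsub x vone) x).
  { intro x. unfold vlt. replace (vsub x (vsub x vone)) with (@vone X) by vec_eq. apply pos_one. }
  intro H.
  destruct (classic (lo = [])) as [->|Hlo]; destruct (classic (up = [])) as [->|Hup].
  - exists vzero; simpl; split; intros ? [].

  - destruct (Hmin _ Hup) as [m [Hm1 Hm2]]. exists (vsub m vone). split; [simpl; contradiction|].
    intros y Hy. destruct (Hm2 _ Hy) as [->|Hy']; auto. eapply vlt_trans; [apply H2|exact Hy'].
  - destruct (Hmax _ Hlo) as [m [Hm1 Hm2]]. exists (vadd m vone). split; [|simpl; contradiction].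
    intros y Hy. destruct (Hm2 _ Hy) as [->|Hy']; auto. eapply vlt_trans; [eassumption|auto].
  - destruct (Hmax _ Hlo) as [m [Hm1 Hm2]]. destruct (Hmin _ Hup) as [p [Hp1 Hp2]].
    assert (Hmp : vlt m p) by auto.
    assert (Hm : vlt m (vscal (/2) (vadd m p))).
    { unfold vlt in *. replace (vsub (vscal (/ 2) (vadd m p)) m) with (vscal (/2) (vsub p m)) by vec_eq.
      apply pos_scal; auto; lra. }
    assert (Hp : vlt (vscal (/2) (vadd m p)) p).
    { unfold vlt in *. replace (vsub p (vscal (/ 2) (vadd m p))) with (vscal (/2) (vsub p m)) by vec_eq.
      apply pos_scal; auto; lra. }
    exists (vscal (/2) (vadd m p)). split; intros y Hy.
    + destruct (Hm2 _ Hy) as [->|Hy']; auto. eapply vlt_trans; [eassumption|auto].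
    + destruct (Hp2 _ Hy) as [->|Hy']; auto. eapply vlt_trans; eassumption.
Qed.

Definition same_sign {X Y : ovs} (x : X) (y : Y) : Prop :=
  (vpos x <-> vpos y) /\ (x = vzero <-> y = vzero).

Lemma same_sign_sym (X Y : ovs) (x : X) (y : Y) : same_sign x y -> same_sign y x.
Proof. unfold same_sign; tauto. Qed.

Lemma same_sign_neg (X Y : ovs) (x : X) (y : Y) :
  same_sign x y -> (vpos (vscal (-1) x) <-> vpos (vscal (-1) y)).
Proof. unfold same_sign. rewrite !pos_neg. tauto. Qed.

Lemma vscal_eq0 (X : ovs) (a : R) (x : X) : a <> 0 -> (vscal a x = vzero <-> x = vzero).
Proof.
  intro Ha; split; intro H.
  - replace x with (vscal (/ a) (vscal a x)) by vec_eq. rewrite H. vec_eq.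
  - subst. vec_eq.
Qed.

Lemma pos_scal_iff (X : ovs) (a : R) (x : X) : 0 < a -> (vpos (vscal a x) <-> vpos x).
Proof.
  intro Ha; split; intro H.
  - replace x with (vscal (/ a) (vscal a x)) by vec_eq.
    apply pos_scal; auto. now apply Rinv_0_lt_compat.
  - now apply pos_scal.
Qed.

Lemma same_sign_scal (X Y : ovs) (a : R) (x : X) (y : Y) :
  a <> 0 -> same_sign x y -> same_sign (vscal a x) (vscal a y).
Proof.
  intros Ha H. split; [|now rewrite !vscal_eq0 by auto; apply H].
  destruct (Rtotal_order a 0) as [Ha'|[Ha'|Ha']]; [|contradiction|].
  - replace (vscal a x) with (vscal (- a) (vscal (-1) x)) by vec_eq.
    replace (vscal a y) with (vscal (- a) (vscal (-1) y)) by vec_eq.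
    rewrite (pos_scal_iff X (- a)), (pos_scal_iff Y (- a)) by lra. now apply same_sign_neg.
  - rewrite (pos_scal_iff X a), (pos_scal_iff Y a) by lra. apply H.
Qed.

Lemma same_sign_sub (X Y : ovs) (x x' : X) (y y' : Y) :
  (vlt x x' /\ vlt y y') \/ (x = x' /\ y = y') \/ (vlt x' x /\ vlt y' y) ->
  same_sign (vsub x x') (vsub y y').
Proof.
  assert (Hneg : forall (Z : ovs) (z z' : Z), vlt z z' -> ~ vpos (vsub z z') /\ vsub z z' <> vzero).
  { intros Z z z' H. split; [intro H'|rewrite vsub_zero; intro; subst].
    - apply (vlt_irr Z z). eapply vlt_trans; [apply H|]. exact H'.
    - now apply (vlt_irr Z z'). }
  assert (Hp : forall (Z : ovs) (z z' : Z), vlt z' z -> vpos (vsub z z') /\ vsub z z' <> vzero).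
  { intros Z z z' H. split; [exact H|rewrite vsub_zero; intro; subst].
    now apply (vlt_irr Z z'). }
  intros [[H1 H2]|[[-> ->]|[H1 H2]]].
  - apply Hneg in H1. apply Hneg in H2. unfold same_sign; tauto.
  - assert (E1 : vsub x' x' = vzero) by now apply vsub_zero.
    assert (E2 : vsub y' y' = vzero) by now apply vsub_zero.
    rewrite E1, E2. generalize (pos_zero X) (pos_zero Y). unfold same_sign; tauto.
  - apply Hp in H1. apply Hp in H2. unfold same_sign; tauto.
Qed.

(** The back-and-forth step: [d] is one of the given points, and its partner is taken, or [d] fills
    a cut among them, and the matching cut is filled by density. *)
Lemma same_pattern_extend (X Y : ovs) (l : list (X * Y)) (d : X) :
  (forall p q, In p l -> In q l -> same_sign (vsub (fst p) (fst q)) (vsub (snd p) (snd q))) ->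
  exists d' : Y, forall p, In p l -> same_sign (vsub d (fst p)) (vsub d' (snd p)).
Proof.
  intro Hl. destruct (classic (exists p, In p l /\ fst p = d)) as [[p [Hp <-]]|Hd].
  - exists (snd p). auto.
  - pose (lo := filter (fun p => if excluded_middle_informative (vlt (fst p) d) then true else false) l).
    pose (up := filter (fun p => if excluded_middle_informative (vlt d (fst p)) then true else false) l).
    assert (Hlo : forall p, In p lo <-> In p l /\ vlt (fst p) d).
    { intro p. unfold lo. rewrite filter_In. destruct excluded_middle_informative; intuition congruence. }
    assert (Hup : forall p, In p up <-> In p l /\ vlt d (fst p)).
    { intro p. unfold up. rewrite filter_In. destruct excluded_middle_informative; intuition congruence. }
    destruct (vlt_between Y (map snd lo) (map snd up)) as [d' [H1 H2]].
    + intros x y Hx Hy. apply in_map_iff in Hx, Hy.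
      destruct Hx as [p [<- Hp]], Hy as [q [<- Hq]].
      apply Hlo in Hp. apply Hup in Hq. unfold vlt.
      apply (Hl q p); [tauto|tauto|]. eapply vlt_trans; [apply Hp|apply Hq].
    + exists d'. intros p Hp. apply same_sign_sub.
      destruct (vlt_total X d (fst p)) as [H|[H|H]].
      * exfalso. apply Hd. exists p. auto.
      * left. split; auto. apply H2, in_map, Hup; auto.
      * right; right. split; auto. apply H1, in_map, Hlo; auto.
Qed.

(** * Linear forms and Fourier-Motzkin elimination *)

(* [(a, None)] stands for the constant [a * 1] and [(a, Some n)] for [a * x_n]. *)
Definition form : Type := list (R * option nat).

Fixpoint fev {X : ovs} (e : nat -> X) (f : form) : X :=
  match f with
  | [] => vzero
  | (a, None) :: r => vadd (vscal a vone) (fev e r)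
  | (a, Some n) :: r => vadd (vscal a (e n)) (fev e r)
  end.

Definition fscal (a : R) (f : form) : form := map (fun m => (a * fst m, snd m)) f.
Definition fsub (f g : form) : form := f ++ fscal (-1) g.

Fixpoint fcoef (y : nat) (f : form) : R :=
  match f with
  | [] => 0
  | (a, None) :: r => fcoef y r
  | (a, Some n) :: r => (if Nat.eqb n y then a else 0) + fcoef y r
  end.

Definition fdrop (y : nat) (f : form) : form :=
  filter (fun m => match snd m with Some n => negb (Nat.eqb n y) | None => true end) f.

Lemma fev_app (X : ovs) (e : nat -> X) f g : fev e (f ++ g) = vadd (fev e f) (fev e g).
Proof.
  induction f as [|[a [n|]] f IH]; simpl.
  - vec_eq.
  - rewrite IH. vec_eq.
  - rewrite IH. vec_eq.
Qed.

Lemma fev_scal (X : ovs) (e : nat -> X) a f : fev e (fscal a f) = vscal a (fev e f).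
Proof.
  unfold fscal. induction f as [|[b [n|]] f IH]; simpl.
  - vec_eq.
  - rewrite IH. vec_eq.
  - rewrite IH. vec_eq.
Qed.

Lemma fev_sub (X : ovs) (e : nat -> X) f g : fev e (fsub f g) = vsub (fev e f) (fev e g).
Proof. unfold fsub, vsub. now rewrite fev_app, fev_scal. Qed.

Lemma fev_upd (X : ovs) (e : nat -> X) y d f :
  fev (upd e y d) f = vadd (vscal (fcoef y f) d) (fev e (fdrop y f)).
Proof.
  induction f as [|[a [n|]] f IH]; simpl.
  - vec_eq.
  - rewrite IH. unfold upd at 1. destruct (Nat.eqb n y); simpl; vec_eq.
  - rewrite IH. vec_eq.
Qed.

(** The value of [y] at which [f] vanishes, as a form in the other variables; meaningful when [y]
    has a nonzero coefficient. *)
Definition froot (y : nat) (f : form) : form := fscal (- / fcoef y f) (fdrop y f).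

Lemma fev_root (X : ovs) (e : nat -> X) y d f : fcoef y f <> 0 ->
  fev (upd e y d) f = vscal (fcoef y f) (vsub d (fev e (froot y f))).
Proof.
  intro H. rewrite fev_upd. unfold froot. rewrite fev_scal. apply co_inj; intro; unfold vsub.
  repeat first [rewrite co_add | rewrite co_scal]. now field.
Qed.

Definition involves (y : nat) (f : form) : bool :=
  if Req_EM_T (fcoef y f) 0 then false else true.

(** The signs at a value of [y] depend only on its position among the roots, so the order of the
    roots is recorded by their differences. Forms in which the occurrences of [y] cancel are
    stripped of them. *)
Definition felim (y : nat) (S : list form) : list form :=
  map (fdrop y) (filter (fun f => negb (involves y f)) S) ++
  map (fun p => fsub (froot y (fst p)) (froot y (snd p)))
      (list_prod (filter (involves y) S) (filter (involves y) S)).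

Definition agree {X Y : ovs} (S : list form) (e : nat -> X) (e' : nat -> Y) : Prop :=
  forall f, In f S -> same_sign (fev e f) (fev e' f).

Lemma agree_sym (X Y : ovs) S (e : nat -> X) (e' : nat -> Y) : agree S e e' -> agree S e' e.
Proof. intros H f Hf. apply same_sign_sym. auto. Qed.

Lemma agree_elim (X Y : ovs) S y (e : nat -> X) (e' : nat -> Y) (d : X) :
  agree (felim y S) e e' -> exists d', agree S (upd e y d) (upd e' y d').
Proof.
  intro H.
  destruct (same_pattern_extend X Y
    (map (fun f => (fev e (froot y f), fev e' (froot y f))) (filter (involves y) S)) d) as [d' Hd'].
  - intros p q Hp Hq. apply in_map_iff in Hp, Hq.
    destruct Hp as [f [<- Hf]], Hq as [g [<- Hg]]. simpl. rewrite <- !fev_sub. apply H.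
    apply in_or_app. right. apply in_map_iff. exists (f, g). split; auto. now apply in_prod.
  - exists d'. intros f Hf. destruct (involves y f) eqn:Hi.
    + assert (Hc : fcoef y f <> 0) by (unfold involves in Hi; destruct Req_EM_T; congruence).
      rewrite !fev_root by auto. apply same_sign_scal; auto.
      apply (Hd' (fev e (froot y f), fev e' (froot y f))).
      apply in_map_iff. exists f. split; auto. apply filter_In. auto.
    + assert (Hc : fcoef y f = 0) by (unfold involves in Hi; destruct Req_EM_T; congruence).
      rewrite !fev_upd, Hc.
      replace (vadd (vscal 0 d) (fev e (fdrop y f))) with (fev e (fdrop y f)) by vec_eq.
      replace (vadd (vscal 0 d') (fev e' (fdrop y f))) with (fev e' (fdrop y f)) by vec_eq.
      apply H. apply in_or_app. left. apply in_map, filter_In. rewrite Hi. auto.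
Qed.

(** Both quantifiers are treated alike: instead of an equivalent formula, only a finite list of
    forms is produced whose signs decide [phi]. *)
Fixpoint forms (lin : term -> form) (phi : formula) : list form :=
  match phi with
  | FEq u v | FLt u v => [fsub (lin u) (lin v)]
  | FBot => []
  | FImp g h | FAnd g h | FOr g h => forms lin g ++ forms lin h
  | FAll y g | FEx y g => felim y (forms lin g)
  end.

Definition fvars_in (P : nat -> Prop) (f : form) : Prop := forall a n, In (a, Some n) f -> P n.

Lemma fvars_in_scal P a f : fvars_in P f -> fvars_in P (fscal a f).
Proof.
  intros H b n Hb. apply in_map_iff in Hb. destruct Hb as [[c o] [Hc Hb]].
  injection Hc as _ ->. eapply H, Hb.
Qed.

Lemma fvars_in_weaken (P Q : nat -> Prop) f : (forall n, P n -> Q n) -> fvars_in P f -> fvars_in Q f.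
Proof. intros H Hf a n Hn. eauto. Qed.

Lemma fvars_in_app P f g : fvars_in P f -> fvars_in P g -> fvars_in P (f ++ g).
Proof. intros H1 H2 b n Hb. apply in_app_or in Hb. destruct Hb; eauto. Qed.

Lemma fvars_in_drop P y f : fvars_in P f -> fvars_in (fun x => x <> y /\ P x) (fdrop y f).
Proof.
  intros H b n Hb. apply filter_In in Hb. destruct Hb as [Hb Hn]. split; eauto.
  simpl in Hn. intros ->. rewrite Nat.eqb_refl in Hn. discriminate.
Qed.

Lemma fvars_forms lin phi :
  (forall t, fvars_in (fun x => occurs_t x t) (lin t)) ->
  forall f, In f (forms lin phi) -> fvars_in (fun x => occurs_free x phi) f.
Proof.
  intro Hlin.
  assert (Hat : forall u v, fvars_in (fun x => occurs_t x u \/ occurs_t x v) (fsub (lin u) (lin v))).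
  { intros u v. apply fvars_in_app; [|apply fvars_in_scal]; intros a n H; apply Hlin in H; auto. }
  assert (Hel : forall y S (P : nat -> Prop), (forall f, In f S -> fvars_in P f) ->
            forall f, In f (felim y S) -> fvars_in (fun x => x <> y /\ P x) f).
  { intros y S P HS f Hf. apply in_app_or in Hf. destruct Hf as [Hf|Hf]; apply in_map_iff in Hf.
    - destruct Hf as [g [<- Hg]]. apply filter_In in Hg. apply fvars_in_drop, HS; tauto.
    - destruct Hf as [[g h] [<- Hg]]. apply in_prod_iff in Hg. rewrite !filter_In in Hg.
      apply fvars_in_app; [|apply fvars_in_scal]; apply fvars_in_scal, fvars_in_drop, HS; tauto. }
  induction phi; simpl; intros f Hf;
    try (destruct Hf as [<-|[]]; apply Hat);
    try (apply in_app_or in Hf; intros a m Hm; destruct Hf as [Hf|Hf];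
         [left; eapply IHphi1 | right; eapply IHphi2]; eauto; fail).
  - contradiction.
  - eapply Hel; eauto.
  - eapply Hel; eauto.
Qed.

(** A form without variables is a real multiple of [vone], and its sign is that of the real factor
    in every space. *)
Lemma agree_closed (X Y : ovs) S (e : nat -> X) (e' : nat -> Y) :
  (forall f, In f S -> fvars_in (fun _ => False) f) -> agree S e e'.
Proof.
  intros H f Hf. specialize (H f Hf).
  assert (Hc : exists c, fev e f = vscal c vone /\ fev e' f = vscal c vone).
  { clear Hf. induction f as [|[a [n|]] f IH]; simpl.
    - exists 0. split; vec_eq.
    - exfalso. apply (H a n). now left.
    - destruct IH as [c [-> ->]].
      + intros b n Hb. apply (H b n). now right.
      + exists (a + c). split; vec_eq. }
  destruct Hc as [c [-> ->]].
  destruct (Req_dec c 0) as [->|Hc].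
  - replace (vscal 0 (@vone X)) with (@vzero X) by vec_eq.
    replace (vscal 0 (@vone Y)) with (@vzero Y) by vec_eq.
    generalize (pos_zero X) (pos_zero Y). unfold same_sign; tauto.
  - apply same_sign_scal; auto.
    assert (Hone : forall Z : ovs, @vone Z <> vzero).
    { intros Z HZ. apply (pos_zero Z). rewrite <- HZ. apply pos_one. }
    generalize (pos_one X) (pos_one Y) (Hone X) (Hone Y). unfold same_sign; tauto.
Qed.

(** * Transfer of truth between coded structures *)

Section Transfer.

(* Elements of a structure are coded by a label (for products, the sign) and a vector (for products, the logarithm); only the vectors enter the linear forms. *)
Variables (K : Type) (X Y : ovs) (M N : structure).
Variables (repM : K -> X -> carrier M) (repN : K -> Y -> carrier N).
Hypothesis surjM : forall d, exists k x, repM k x = d.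
Hypothesis surjN : forall d, exists k x, repN k x = d.
Variables (P : term -> Prop) (lin : term -> form).

Definition code_env {Z : ovs} {A : Type} (rep : K -> Z -> A) (s : nat -> K) (e : nat -> Z) : nat -> A :=
  fun n => rep (s n) (e n).

Hypothesis atoms : forall u v, P u -> P v -> forall s e e',
  same_sign (fev e (fsub (lin u) (lin v))) (fev e' (fsub (lin u) (lin v))) ->
  (sat M (code_env repM s e) (FEq u v) <-> sat N (code_env repN s e') (FEq u v)) /\
  (sat M (code_env repM s e) (FLt u v) <-> sat N (code_env repN s e') (FLt u v)).

Lemma upd_code_env {Z : ovs} {A : Type} (rep : K -> Z -> A) s e y k d :
  upd (code_env rep s e) y (rep k d) = code_env rep (upd s y k) (upd e y d).
Proof.
  extensionality n. unfold upd, code_env. now destruct (Nat.eqb n y).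
Qed.

(** The label of a new element is copied and only its vector is matched, so one label assignment [s]
    serves both structures. *)
Lemma transfer phi : formula_in P phi -> forall s e e', agree (forms lin phi) e e' ->
  (sat M (code_env repM s e) phi <-> sat N (code_env repN s e') phi).
Proof.
  assert (Happ : forall S T (e : nat -> X) (e' : nat -> Y),
            agree (S ++ T) e e' -> agree S e e' /\ agree T e e').
  { intros S T e e' H. split; intros f Hf; apply H, in_or_app; auto. }
  assert (HM : forall y S (s : nat -> K) (e : nat -> X) (e' : nat -> Y) d, agree (felim y S) e e' ->
     exists k x x', repM k x = d /\ agree S (upd e y x) (upd e' y x')).
  { intros y S s e e' d H. destruct (surjM d) as [k [x Hx]].
    destruct (agree_elim _ _ _ _ _ _ x H) as [x' Hx']. exists k, x, x'; auto. }
  assert (HN : forall y S (s : nat -> K) (e : nat -> X) (e' : nat -> Y) d, agree (felim y S) e e' ->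
     exists k x x', repN k x' = d /\ agree S (upd e y x) (upd e' y x')).
  { intros y S s e e' d H. destruct (surjN d) as [k [x' Hx']].
    destruct (agree_elim _ _ _ _ _ _ x' (agree_sym _ _ _ _ _ H)) as [x Hx].
    exists k, x, x'. split; auto. now apply agree_sym. }
  induction phi; simpl formula_in; intros HP s e e' H.
  - apply atoms; try tauto. apply H. now left.
  - apply atoms; try tauto. apply H. now left.
  - simpl; tauto.
  - apply Happ in H. simpl. rewrite (IHphi1 (proj1 HP) s e e'), (IHphi2 (proj2 HP) s e e'); tauto.
  - apply Happ in H. simpl. rewrite (IHphi1 (proj1 HP) s e e'), (IHphi2 (proj2 HP) s e e'); tauto.
  - apply Happ in H. simpl. rewrite (IHphi1 (proj1 HP) s e e'), (IHphi2 (proj2 HP) s e e'); tauto.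
  - simpl. split; intros Hs d.
    + destruct (HN _ _ s _ _ d H) as (k & x & x' & <- & Hx). rewrite upd_code_env.
      apply (IHphi HP _ _ _ Hx). rewrite <- upd_code_env. apply Hs.
    + destruct (HM _ _ s _ _ d H) as (k & x & x' & <- & Hx). rewrite upd_code_env.
      apply (IHphi HP _ _ _ Hx). rewrite <- upd_code_env. apply Hs.
  - simpl. split; intros [d Hs].
    + destruct (HM _ _ s _ _ d H) as (k & x & x' & <- & Hx). rewrite upd_code_env in Hs.
      exists (repN k x'). rewrite upd_code_env. now apply (IHphi HP _ _ _ Hx).
    + destruct (HN _ _ s _ _ d H) as (k & x & x' & <- & Hx). rewrite upd_code_env in Hs.
      exists (repM k x). rewrite upd_code_env. now apply (IHphi HP _ _ _ Hx).
Qed.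

Lemma code_env_surj {Z : ovs} {A : Type} (rep : K -> Z -> A) (env : nat -> A) :
  (forall d, exists k x, rep k x = d) -> exists s e, env = code_env rep s e.
Proof.
  intro H.
  assert (H' : forall n, {p : K * Z | rep (fst p) (snd p) = env n}).
  { intro n. apply constructive_indefinite_description.
    destruct (H (env n)) as [k [x Hx]]. now exists (k, x). }
  exists (fun n => fst (proj1_sig (H' n))), (fun n => snd (proj1_sig (H' n))).
  extensionality n. unfold code_env. symmetry. apply (proj2_sig (H' n)).
Qed.

Lemma transfer_sentence phi : formula_in P phi ->
  (forall t, fvars_in (fun x => occurs_t x t) (lin t)) -> sentence phi ->
  (forall env, sat N env phi) -> forall env, sat M env phi.
Proof.
  intros HP Hlin Hs HN env.
  destruct (code_env_surj repM env surjM) as (s & e & ->).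
  (* All forms of a sentence are closed, so the vectors on the side of [N] are arbitrary. *)
  apply (transfer phi HP s e (fun _ => vzero)); auto.
  apply agree_closed. intros f Hf a n Hn.
  apply (Hs n). eapply fvars_forms; eauto.
Qed.

End Transfer.

(** * Models of the additive and of the multiplicative theory *)

Program Definition Rovs : ovs :=
  {| vec := R; idx := unit; co := fun x _ => x; vadd := Rplus; vscal := Rmult;
     vzero := 0; vone := 1; vpos := fun x => 0 < x |}.
Next Obligation. exact (H tt). Qed.
Next Obligation. lra. Qed.
Next Obligation. now apply Rmult_lt_0_compat. Qed.
Next Obligation. lra. Qed.
Next Obligation. lra. Qed.
Next Obligation. lra. Qed.

Fixpoint lin_add (t : term) : form :=
  match t with
  | Var n => [(1, Some n)]
  | One => [(1, None)]
  | Add u v => lin_add u ++ lin_add v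
  | Sub u v => fsub (lin_add u) (lin_add v)
  | Scal a u => fscal a (lin_add u)
  | _ => []
  end.

(* The logarithm of the absolute value of [t], where [t <> 0]. *)
Fixpoint lin_mul (t : term) : form :=
  match t with
  | Var n => [(1, Some n)]
  | Mul u v => lin_mul u ++ lin_mul v
  | Div u v => fsub (lin_mul u) (lin_mul v)
  | Scal a u => (ln (Rabs a), None) :: lin_mul u
  | _ => []
  end.

Lemma fvars_lin_add t : fvars_in (fun x => occurs_t x t) (lin_add t).
Proof.
  induction t; simpl; try (intros b m [Hm|[]]; congruence); try (intros b m []).
  - apply fvars_in_app; eapply fvars_in_weaken; try eassumption; tauto.
  - apply fvars_in_app; [|apply fvars_in_scal]; eapply fvars_in_weaken; try eassumption; tauto.
  - now apply fvars_in_scal.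
Qed.

Lemma fvars_lin_mul t : fvars_in (fun x => occurs_t x t) (lin_mul t).
Proof.
  induction t; simpl; try (intros b m [Hm|[]]; congruence); try (intros b m []).
  - apply fvars_in_app; eapply fvars_in_weaken; try eassumption; tauto.
  - apply fvars_in_app; [|apply fvars_in_scal]; eapply fvars_in_weaken; try eassumption; tauto.
  - congruence.
  - now apply IHt with (a := b).
Qed.

Record add_rep (M : structure) (X : ovs) (r : X -> carrier M) : Prop := {
  ar_surj : forall d, exists x, r x = d;
  ar_inj : forall x y, r x = r y -> x = y;
  ar_zero : s_zero M = r vzero;
  ar_one : s_one M = r vone;
  ar_add : forall x y, s_add M (r x) (r y) = r (vadd x y);
  ar_sub : forall x y, s_sub M (r x) (r y) = r (vsub x y);
  ar_scal : forall a x, s_scal M a (r x) = r (vscal a x);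
  ar_lt : forall x y, s_lt M (r x) (r y) <-> vlt x y }.

Lemma add_rep_eval M X r : add_rep M X r -> forall F e t, add_term F t ->
  eval M (fun n => r (e n)) t = r (fev e (lin_add t)).
Proof.
  intros HM F e. induction t; simpl; intro Ht.
  - f_equal. vec_eq.
  - apply (ar_zero _ _ _ HM).
  - rewrite (ar_one _ _ _ HM). f_equal. vec_eq.
  - rewrite IHt1, IHt2, (ar_add _ _ _ HM), fev_app; tauto.
  - rewrite IHt1, IHt2, (ar_sub _ _ _ HM), fev_sub; tauto.
  - tauto.
  - tauto.
  - rewrite IHt, (ar_scal _ _ _ HM), fev_scal; tauto.
Qed.

Lemma add_rep_R : add_rep Rstruct Rovs (fun x => x).
Proof.
  constructor; simpl; auto; unfold vsub, vlt; simpl; intros.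
  - eauto.
  - ring.
  - unfold vsub; simpl. lra.
Qed.

(** The real line is itself such a space, and by elimination no additive sentence separates it from
    [X]. The labels are trivial here. *)
Lemma add_rep_T_add F M X r : add_rep M X r ->
  forall phi, T_add F phi -> forall env, sat M env phi.
Proof.
  intros HM phi (Hs & HF & HR).
  assert (Hat : forall M X r, add_rep M X r -> forall (s : nat -> unit) e u v,
     add_term F u -> add_term F v ->
     (sat M (code_env unit (fun _ => r) s e) (FEq u v) <-> fev e (fsub (lin_add u) (lin_add v)) = vzero) /\
     (sat M (code_env unit (fun _ => r) s e) (FLt u v) <->
        vpos (vscal (-1) (fev e (fsub (lin_add u) (lin_add v)))))).
  { clear. intros M X r HM s e u v Hu Hv. simpl. unfold code_env.
    rewrite !(add_rep_eval _ _ _ HM F) by auto. rewrite fev_sub. split.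
    - rewrite vsub_zero. split; [apply (ar_inj _ _ _ HM)|congruence].
    - rewrite (ar_lt _ _ _ HM). unfold vlt.
      match goal with |- vpos ?a <-> vpos ?b => replace a with b by vec_eq end. tauto. }
  apply (transfer_sentence unit X Rovs M Rstruct (fun _ => r) (fun _ x => x)) with (P := add_term F) (lin := lin_add);
    auto.
  - intro d. exists tt. apply (ar_surj _ _ _ HM).
  - intro d. exists tt, d. reflexivity.
  - intros u v Hu Hv s e e' H.
    rewrite !(proj1 (Hat _ _ _ HM s e u v Hu Hv)), !(proj2 (Hat _ _ _ HM s e u v Hu Hv)).
    rewrite !(proj1 (Hat _ _ _ add_rep_R s e' u v Hu Hv)), !(proj2 (Hat _ _ _ add_rep_R s e' u v Hu Hv)).
    split; [apply H|now apply same_sign_neg].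
  - apply fvars_lin_add.
Qed.

Definition csgn (a : R) : comparison :=
  match total_order_T a 0 with
  | inleft (left _) => Lt
  | inleft (right _) => Eq
  | inright _ => Gt
  end.

Definition cmul (k l : comparison) : comparison :=
  match k, l with
  | Eq, _ | _, Eq => Eq
  | Gt, Gt | Lt, Lt => Gt
  | _, _ => Lt
  end.

Definition clt (k l : comparison) : Prop :=
  match k, l with Lt, Eq | Lt, Gt | Eq, Gt => True | _, _ => False end.

(** An element is a sign and a logarithm, the latter ignored when the sign is [Eq]. This makes x÷0 =
    0 an instance of [mr_div], and the value of [ln] at 0 harmless in [mr_scal]. Scaling becomes
    translation by a multiple of [vone], so it stays within linear forms. *)
Record mul_rep (M : structure) (X : ovs) (r : comparison -> X -> carrier M) : Prop := {
  mr_surj : forall d, exists k x, r k x = d;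
  mr_eq : forall k l x y, r k x = r l y <-> k = l /\ (k = Eq \/ x = y);
  mr_zero : s_zero M = r Eq vzero;
  mr_one : s_one M = r Gt vzero;
  mr_mul : forall k l x y, s_mul M (r k x) (r l y) = r (cmul k l) (vadd x y);
  mr_div : forall k l x y, s_div M (r k x) (r l y) = r (cmul k l) (vsub x y);
  mr_scal : forall a k x, s_scal M a (r k x) =
              r (cmul (csgn a) k) (vadd (vscal (ln (Rabs a)) vone) x);
  mr_lt : forall k l x y, s_lt M (r k x) (r l y) <->
     clt k l \/ (k = Gt /\ l = Gt /\ vlt x y) \/ (k = Lt /\ l = Lt /\ vlt y x) }.

Fixpoint sgn_mul (s : nat -> comparison) (t : term) : comparison :=
  match t with
  | Var n => s n
  | One => Gt
  | Mul u v | Div u v => cmul (sgn_mul s u) (sgn_mul s v)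
  | Scal a u => cmul (csgn a) (sgn_mul s u)
  | _ => Eq
  end.

Lemma mul_rep_eval M X r : mul_rep M X r -> forall F s e t, mult_term F t ->
  eval M (code_env comparison r s e) t = r (sgn_mul s t) (fev e (lin_mul t)).
Proof.
  intros HM F s e. induction t; simpl; intro Ht.
  - unfold code_env. f_equal. vec_eq.
  - apply (mr_zero _ _ _ HM).
  - apply (mr_one _ _ _ HM).
  - tauto.
  - tauto.
  - rewrite IHt1, IHt2, (mr_mul _ _ _ HM), fev_app; tauto.
  - rewrite IHt1, IHt2, (mr_div _ _ _ HM), fev_sub; tauto.
  - rewrite IHt, (mr_scal _ _ _ HM); tauto.
Qed.

(** * The structure with multiplication transported along an exponential *)

(** [ex_shift] is what lets one scaling on [W] satisfy both the additive and the multiplicative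
    theory. *)
Record expo (W V : ovs) (E : V -> W) : Prop := {
  ex_pos : forall v, vpos (E v);
  ex_surj : forall w, vpos w -> exists v, E v = w;
  ex_mono : forall u v, vlt u v -> vlt (E u) (E v);
  ex_shift : forall v a, E (vadd (vscal a vone) v) = vscal (exp a) (E v);
  ex_zero : E vzero = vone }.

Section Exponential.

Variables (W V : ovs) (E : V -> W) (HE : expo W V E).

Definition erep (k : comparison) (v : V) : W :=
  match k with Gt => E v | Eq => vzero | Lt => vscal (-1) (E v) end.

Lemma erep_surj (d : W) : exists k v, erep k v = d.
Proof.
  destruct (pos_total W d) as [->|[H|H]].
  - now exists Eq, vzero.
  - destruct (ex_surj _ _ _ HE _ H) as [v <-]. now exists Gt, v.
  - destruct (ex_surj _ _ _ HE _ H) as [v Hv]. exists Lt, v. simpl. rewrite Hv. vec_eq.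
Qed.

Lemma erep_lt k l x y : vlt (erep k x) (erep l y) <->
  clt k l \/ (k = Gt /\ l = Gt /\ vlt x y) \/ (k = Lt /\ l = Lt /\ vlt y x).
Proof.
  assert (Hm : forall u v, vlt (E u) (E v) <-> vlt u v).
  { intros u v; split; [|apply (ex_mono _ _ _ HE)]. intro H.
    destruct (vlt_total V u v) as [->|[H'|H']]; auto; exfalso.
    - now apply vlt_irr in H.
    - apply (vlt_irr W (E v)). eapply vlt_trans; [apply (ex_mono _ _ _ HE), H'|exact H]. }
  assert (Hp : forall u, vpos (E u)) by apply (ex_pos _ _ _ HE).
  assert (Hn : forall u, ~ vpos (vscal (-1) (E u))).
  { intros u. rewrite pos_neg. intros [H _]. now apply H. }
  assert (Hopp : forall u v : W, vlt (vscal (-1) u) (vscal (-1) v) <-> vlt v u).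
  { intros u v. unfold vlt.
    match goal with |- vpos ?a <-> vpos ?b => replace a with b by vec_eq end. tauto. }
  assert (H0 : forall u : W, vlt vzero u <-> vpos u).
  { intros u. unfold vlt. replace (vsub u vzero) with u by vec_eq. tauto. }
  assert (H1 : forall u : W, vlt u vzero <-> vpos (vscal (-1) u)).
  { intros u. unfold vlt.
    match goal with |- vpos ?a <-> vpos ?b => replace a with b by vec_eq end. tauto. }
  assert (H2 : forall u v : W, vpos u -> vpos v -> vlt (vscal (-1) u) v).
  { intros u v Hu Hv. unfold vlt. replace (vsub v (vscal (-1) u)) with (vadd v u) by vec_eq.
    now apply pos_add. }
  assert (H3 : forall u v : W, vpos u -> vpos v -> ~ vlt v (vscal (-1) u)).
  { intros u v Hu Hv H. apply (vlt_irr W v). eapply vlt_trans; [apply H|]. now apply H2. }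
  destruct k, l; simpl; rewrite ?Hopp, ?Hm, ?H0, ?H1; split; intro H;
    try tauto; try (exfalso; eapply Hn; eassumption);
    try (exfalso; eapply H3; [| |eassumption]; auto; fail);
    try (destruct H as [[]|[(?&?&?)|(?&?&?)]]; try discriminate; auto; fail); auto.
  - now apply pos_zero in H.
  - replace (vscal (-1) (vscal (-1) (E x))) with (E x) by vec_eq. auto.
Qed.

Lemma erep_eq k l x y : erep k x = erep l y <-> k = l /\ (k = Eq \/ x = y).
Proof.
  split.
  - intro H.
    assert (H1 : ~ vlt (erep k x) (erep l y)) by (rewrite H; apply vlt_irr).
    assert (H2 : ~ vlt (erep l y) (erep k x)) by (rewrite H; apply vlt_irr).
    rewrite erep_lt in H1, H2. destruct (vlt_total V x y) as [H3|[H3|H3]];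
      destruct k, l; simpl in *; tauto.
  - intros [-> [->| ->]]; reflexivity.
Qed.

Lemma erep_scal a k x :
  vscal a (erep k x) = erep (cmul (csgn a) k) (vadd (vscal (ln (Rabs a)) vone) x).
Proof.
  assert (Hs : a <> 0 -> E (vadd (vscal (ln (Rabs a)) vone) x) = vscal (Rabs a) (E x)).
  { intro Ha. rewrite (ex_shift _ _ _ HE), exp_ln; auto. now apply Rabs_pos_lt. }
  unfold csgn. destruct total_order_T as [[Ha|Ha]|Ha].
  - rewrite Rabs_left in Hs |- * by lra. destruct k; simpl; rewrite ?Hs by lra; vec_eq.
  - subst. destruct k; simpl; vec_eq.
  - rewrite Rabs_right in Hs |- * by lra. destruct k; simpl; rewrite ?Hs by lra; vec_eq.
Qed.

Definition code (d : W) : comparison * V :=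
  proj1_sig (constructive_indefinite_description (fun p => erep (fst p) (snd p) = d)
    (match erep_surj d with
     | ex_intro _ k (ex_intro _ v H) => ex_intro _ (k, v) H
     end)).

Lemma code_spec d : erep (fst (code d)) (snd (code d)) = d.
Proof. unfold code. now destruct constructive_indefinite_description. Qed.

Definition exp_struct : structure :=
  {| carrier := W; s_zero := vzero; s_one := vone; s_add := vadd; s_sub := vsub;
     s_mul := fun x y => erep (cmul (fst (code x)) (fst (code y))) (vadd (snd (code x)) (snd (code y)));
     s_div := fun x y => erep (cmul (fst (code x)) (fst (code y))) (vsub (snd (code x)) (snd (code y)));
     s_lt := vlt; s_scal := vscal |}.

Lemma exp_struct_add_rep : add_rep exp_struct W (fun x => x).
Proof. constructor; simpl; auto; try tauto. eauto. Qed.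

Lemma exp_struct_mul_rep : mul_rep exp_struct V erep.
Proof.
  (* The operations are defined on chosen codes. Only zero has several, all of sign [Eq], and [cmul]
     propagates [Eq]; the choice is therefore invisible. *)
  assert (Hc : forall op k l x y,
     erep (cmul (fst (code (erep k x))) (fst (code (erep l y))))
          (op (snd (code (erep k x))) (snd (code (erep l y)))) = erep (cmul k l) (op x y)).
  { intros op k l x y.
    pose proof (code_spec (erep k x)) as H1. apply erep_eq in H1.
    pose proof (code_spec (erep l y)) as H2. apply erep_eq in H2.
    destruct H1 as [-> H1], H2 as [-> H2]. apply erep_eq. split; auto.
    destruct H1 as [->| ->]; [now left|]. destruct H2 as [->| ->]; [left; now destruct k|]. now right. }
  constructor; simpl.
  - apply erep_surj.
  - apply erep_eq.
  - reflexivity.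
  - symmetry. apply (ex_zero _ _ _ HE).
  - intros. apply (Hc vadd).
  - intros. apply (Hc vsub).
  - apply erep_scal.
  - apply erep_lt.
Qed.

End Exponential.

Lemma expo_R : expo Rovs Rovs exp.
Proof.
  constructor; simpl; intros.
  - apply exp_pos.
  - exists (ln w). now apply exp_ln.
  - unfold vlt, vsub in *; simpl in *. generalize (exp_increasing u v). lra.
  - rewrite Rmult_1_r. apply exp_plus.
  - apply exp_0.
Qed.

Lemma mul_rep_R : mul_rep Rstruct Rovs (erep Rovs Rovs exp).
Proof.
  assert (Hn0 : forall x, exp x <> 0) by (intro x; generalize (exp_pos x); lra).
  constructor.
  - apply (erep_surj _ _ _ expo_R).
  - apply (erep_eq _ _ _ expo_R).
  - reflexivity.
  - symmetry. apply exp_0.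
  - intros k l x y. destruct k, l; simpl; rewrite ?exp_plus; ring.
  - intros k l x y.
    assert (He : exp (x + -1 * y) = exp x / exp y).
    { rewrite exp_plus. replace (-1 * y) with (- y) by ring. now rewrite exp_Ropp. }
    specialize (Hn0 y).
    destruct k, l; simpl; unfold div0, vsub; simpl; destruct Req_EM_T; try lra; rewrite ?He; field; auto.
  - apply (erep_scal _ _ _ expo_R).
  - intros k l x y. rewrite <- (erep_lt _ _ _ expo_R). unfold vlt, vsub; simpl. lra.
Qed.

(** Truth is transferred from the reals, where a nonzero element is a sign with an ordinary
    logarithm in [Rovs]. *)
Lemma mul_rep_T_mult F M X r : mul_rep M X r ->
  forall phi, T_mult F phi -> forall env, sat M env phi.
Proof.
  intros HM phi (Hs & HF & HR).
  assert (Hat : forall M X r, mul_rep M X r -> forall s e u v,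
     mult_term F u -> mult_term F v ->
     let d := fev e (fsub (lin_mul u) (lin_mul v)) in
     let k := sgn_mul s u in let l := sgn_mul s v in
     (sat M (code_env comparison r s e) (FEq u v) <-> k = l /\ (k = Eq \/ d = vzero)) /\
     (sat M (code_env comparison r s e) (FLt u v) <->
       clt k l \/ (k = Gt /\ l = Gt /\ vpos (vscal (-1) d)) \/ (k = Lt /\ l = Lt /\ vpos d))).
  { clear. intros M X r HM s e u v Hu Hv d k l. subst d k l. simpl.
    rewrite !(mul_rep_eval _ _ _ HM F) by auto. rewrite fev_sub. split.
    - rewrite vsub_zero. apply (mr_eq _ _ _ HM).
    - rewrite (mr_lt _ _ _ HM). unfold vlt.
      match goal with |- context [vpos (vscal (-1) ?a)] =>
        match goal with |- context [vpos (vsub ?b ?c)] => 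
         replace (vscal (-1) a) with (vsub b c) by vec_eq end end. tauto. }
  apply (transfer_sentence comparison X Rovs M Rstruct r (erep Rovs Rovs exp))
    with (P := mult_term F) (lin := lin_mul); auto.
  - apply (mr_surj _ _ _ HM).
  - apply (mr_surj _ _ _ mul_rep_R).
  - intros u v Hu Hv s e e' H.
    rewrite !(proj1 (Hat _ _ _ HM s e u v Hu Hv)), !(proj2 (Hat _ _ _ HM s e u v Hu Hv)).
    rewrite !(proj1 (Hat _ _ _ mul_rep_R s e' u v Hu Hv)), !(proj2 (Hat _ _ _ mul_rep_R s e' u v Hu Hv)).
    rewrite (same_sign_neg _ _ _ _ H), (proj1 H), (proj2 H). split; reflexivity.
  - apply fvars_lin_mul.
Qed.

Lemma exp_struct_model F W V E (HE : expo W V E) : is_model F (exp_struct W V E HE).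
Proof.
  intros phi [H|H].
  - eapply add_rep_T_add; [apply exp_struct_add_rep|eassumption].
  - eapply mul_rep_T_mult; [apply exp_struct_mul_rep|eassumption].
Qed.

(** * Finitely supported functions, ordered by the sign at the largest point of the support *)

Definition finsupp (f : R -> R) : Prop := exists l, forall x, f x <> 0 -> In x l.

Definition fsf : Type := {f : R -> R | finsupp f}.
Definition fval (w : fsf) : R -> R := proj1_sig w.

Lemma fsf_ext (v w : fsf) : (forall x, fval v x = fval w x) -> v = w.
Proof.
  destruct v as [v Hv], w as [w Hw]. simpl. intro H.
  assert (v = w) by (now extensionality x). subst. f_equal. apply proof_irrelevance.
Qed.

Lemma finsupp_add f g : finsupp f -> finsupp g -> finsupp (fun x => f x + g x).
Proof.
  intros [l Hl] [m Hm]. exists (l ++ m). intros x Hx. apply in_or_app.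
  destruct (Req_dec (f x) 0); [|auto]. right. apply Hm. lra.
Qed.

Lemma finsupp_scal a f : finsupp f -> finsupp (fun x => a * f x).
Proof.
  intros [l Hl]. exists l. intros x Hx. apply Hl. intro H. rewrite H in Hx. lra.
Qed.

Lemma finsupp_point c a : finsupp (fun x => if Req_EM_T x c then a else 0).
Proof. exists [c]. intros x Hx. destruct Req_EM_T; [now left|lra]. Qed.

Definition point (c a : R) : fsf := exist _ _ (finsupp_point c a).

Lemma point_at c a : fval (point c a) c = a.
Proof. simpl. destruct Req_EM_T; congruence. Qed.

Lemma point_off c a x : x <> c -> fval (point c a) x = 0.
Proof. simpl. intro. destruct Req_EM_T; congruence. Qed.

Definition lead_pos (f : R -> R) : Prop := exists c, 0 < f c /\ forall x, c < x -> f x = 0.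

Lemma finsupp_lead f : finsupp f ->
  (forall x, f x = 0) \/ exists c, f c <> 0 /\ forall x, c < x -> f x = 0.
Proof.
  intros [l Hl]. revert f Hl. induction l as [|a l IH]; intros f Hl.
  - left. intro x. apply NNPP. intro H. apply (Hl x H).
  - destruct (IH (fun x => if Req_EM_T x a then 0 else f x)) as [H|[c [Hc1 Hc2]]].
    + intros x Hx. destruct Req_EM_T; [lra|]. destruct (Hl x Hx); [congruence|auto].
    + destruct (Req_dec (f a) 0) as [Ha|Ha].
      * left. intro x. specialize (H x). destruct Req_EM_T; subst; auto.
      * right. exists a. split; auto. intros x Hx. specialize (H x). destruct Req_EM_T; subst; auto; lra.
    + right. destruct Req_EM_T; [lra|].
      destruct (Rlt_dec c a) as [Hca|Hca].
      * destruct (Req_dec (f a) 0) as [Ha|Ha].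
        -- exists c. split; auto. intros x Hx. specialize (Hc2 x Hx). destruct Req_EM_T; subst; auto.
        -- exists a. split; auto. intros x Hx. specialize (Hc2 x ltac:(lra)). destruct Req_EM_T; subst; auto; lra.
      * exists c. split; auto. intros x Hx. specialize (Hc2 x Hx). destruct Req_EM_T; subst; auto; lra.
Qed.

Program Definition Wovs : ovs :=
  {| vec := fsf; idx := R; co := fval;
     vadd := fun v w => exist _ _ (finsupp_add _ _ (proj2_sig v) (proj2_sig w));
     vscal := fun a w => exist _ _ (finsupp_scal a _ (proj2_sig w));
     vzero := point 0 0; vone := point 0 1; vpos := fun w => lead_pos (fval w) |}.
Next Obligation. now apply fsf_ext. Qed.
Next Obligation. destruct Req_EM_T; auto. Qed.
Next Obligation.
  destruct H as [c [Hc1 Hc2]], H0 as [d [Hd1 Hd2]]. unfold fval in *. simpl.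
  destruct (Rtotal_order c d) as [H|[H|H]].
  - exists d. rewrite Hc2 by auto. split; [lra|]. intros z Hz. rewrite Hc2, Hd2 by lra. lra.
  - subst. exists d. split; [lra|]. intros z Hz. rewrite Hc2, Hd2 by lra. lra.
  - exists c. rewrite Hd2 by auto. split; [lra|]. intros z Hz. rewrite Hc2, Hd2 by lra. lra.
Qed.
Next Obligation.
  destruct H0 as [c [Hc1 Hc2]]. exists c. unfold fval in *; simpl. split.
  - now apply Rmult_lt_0_compat.
  - intros z Hz. rewrite Hc2 by lra. lra.
Qed.
Next Obligation. intros [c [Hc _]]. simpl in Hc. destruct Req_EM_T; lra. Qed.
Next Obligation.
  destruct (finsupp_lead _ (proj2_sig x)) as [H|[c [Hc1 Hc2]]].
  - left. apply fsf_ext. intro z. simpl. destruct Req_EM_T; apply H.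
  - right. destruct (Rlt_dec 0 (fval x c)).
    + left. exists c. auto.
    + right. exists c. unfold fval in *. simpl. split; [lra|]. intros z Hz. rewrite Hc2 by lra. lra.
Qed.
Next Obligation. exists 0. split; [|intros x Hx]; destruct Req_EM_T; lra. Qed.

(* The space of logarithms and a first exponential *)
#[local] Obligation Tactic := simpl; intros.

(* The logarithms: archimedean class, real part, infinitesimal part. *)
Program Definition Vovs : ovs :=
  {| vec := R * R * Wovs; idx := bool + R;
     co := fun v i => match i with inl true => fst (fst v) | inl false => snd (fst v) | inr x => fval (snd v) x end;
     vadd := fun u v => (fst (fst u) + fst (fst v), snd (fst u) + snd (fst v), vadd (snd u) (snd v));
     vscal := fun a v => (a * fst (fst v), a * snd (fst v), vscal a (snd v));
     vzero := (0, 0, vzero); vone := (0, 1, vzero);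
     vpos := fun v => 0 < fst (fst v) \/ fst (fst v) = 0 /\ (0 < snd (fst v) \/ snd (fst v) = 0 /\ vpos (snd v)) |}.
Next Obligation.
  destruct x as [[a b] f], y as [[a' b'] f'].
  pose proof (H (inl true)) as H1. pose proof (H (inl false)) as H2. simpl in *. subst.
  f_equal. apply fsf_ext. intro x. apply (H (inr x)).
Qed.
Next Obligation. destruct i as [[]|]; auto. Qed.
Next Obligation. destruct i as [[]|]; auto. Qed.
Next Obligation. destruct i as [[]|]; auto. simpl. destruct Req_EM_T; auto. Qed.
Next Obligation.
  assert (Hp : forall x y : Wovs, vpos x -> vpos y -> vpos (vadd x y)) by apply pos_add.
  destruct x as [[a b] f], y as [[a' b'] f']. simpl in *.
  destruct H as [H|[-> [H|[-> H]]]], H0 as [H0|[-> [H0|[-> H0]]]];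
   try (left; lra); right; (split; [lra|]); try (left; lra); right; (split; [lra|]).
  now apply Hp.
Qed.
Next Obligation.
  assert (Hp : forall (x : Wovs), vpos x -> vpos (vscal a x)) by (intros; now apply pos_scal).
  destruct x as [[c b] f]. simpl in *.
  destruct H0 as [H0|[-> [H0|[-> H0]]]].
  - left. now apply Rmult_lt_0_compat.
  - right. split; [lra|]. left. now apply Rmult_lt_0_compat.
  - right. split; [lra|]. right. split; [lra|]. now apply Hp.
Qed.
Next Obligation.
  intros [H|[_ [H|[_ H]]]]; try lra. now apply (pos_zero Wovs).
Qed.
Next Obligation.
  destruct x as [[a b] f]. simpl.
  destruct (Rtotal_order a 0) as [H|[->|H]]; [right; right; left; lra| |right; left; auto].
  destruct (Rtotal_order b 0) as [H|[->|H]]; [right; right; right; split; [lra|left; lra]| |right; left; auto].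
  destruct (pos_total Wovs f) as [->|[H|H]]; [left; auto|right; left; auto|].
  right; right; right. split; [lra|]. right. split; [lra|auto].
Qed.
Next Obligation. right. split; auto. left. lra. Qed.

Definition inf (e : Wovs) : Vovs := (0, 0, e).
Definition infpart (v : Vovs) : R -> R := fval (snd v).

(* [x |-> c - exp (- x)] maps the line onto the half-line below [c]. *)
Definition exp0_fun (v : Vovs) (d : R) : R :=
  let c := fst (fst v) in
  exp (snd (fst v)) *
    match total_order_T d c with
    | inleft (left _) => infpart v (- ln (c - d))
    | inleft (right _) => 1
    | inright _ => 0
    end.

Lemma finsupp_exp0 v : finsupp (exp0_fun v).
Proof.
  destruct v as [[c r] [f [l Hl]]]. exists (c :: map (fun x => c - exp (- x)) l).
  intros d Hd. unfold exp0_fun, infpart in Hd. simpl in Hd.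
  destruct total_order_T as [[H|H]|H].
  - right. apply in_map_iff. exists (- ln (c - d)). rewrite Ropp_involutive, exp_ln by lra. split; [lra|].
    apply Hl. intro H'. rewrite H' in Hd. lra.
  - now left.
  - lra.
Qed.

(** In the notation of Hahn series, [(c, r, f)] goes to e^r t^c (1 + f'), where f' is a copy of [f]
    squeezed below the leading term. *)
Definition exp0 (v : Vovs) : Wovs := exist _ _ (finsupp_exp0 v).

Lemma exp0_below v x : fval (exp0 v) (fst (fst v) - exp (- x)) = exp (snd (fst v)) * infpart v x.
Proof.
  destruct v as [[c r] f]. simpl. unfold exp0_fun; simpl. generalize (exp_pos (- x)); intro.
  destruct total_order_T as [[H1|H1]|H1]; try lra.
  replace (c - (c - exp (- x))) with (exp (- x)) by ring.
  now rewrite ln_exp, Ropp_involutive.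
Qed.

Lemma exp0_lead v : fval (exp0 v) (fst (fst v)) = exp (snd (fst v)).
Proof.
  destruct v as [[c r] f]. simpl. unfold exp0_fun; simpl.
  destruct total_order_T as [[H1|H1]|H1]; lra.
Qed.

Lemma exp0_above v d : fst (fst v) < d -> fval (exp0 v) d = 0.
Proof.
  destruct v as [[c r] f]. simpl. unfold exp0_fun; simpl.
  destruct total_order_T as [[H1|H1]|H1]; lra.
Qed.

Lemma below_exp c d : d < c -> exists x, d = c - exp (- x).
Proof. intro H. exists (- ln (c - d)). rewrite Ropp_involutive, exp_ln; lra. Qed.

(** Since [x |-> c - exp (- x)] is increasing, the largest point where two infinitesimal parts
    differ goes to the largest point where the images differ, so the lexicographic order is
    preserved. *)
Lemma expo_exp0 : expo Wovs Vovs exp0.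
Proof.
  constructor.
  - intro v. exists (fst (fst v)). change (co (o := Wovs)) with fval.
    rewrite exp0_lead. split; [apply exp_pos|apply exp0_above].
  - intros w [c [Hc1 Hc2]].
    (* The infinitesimal part of the logarithm of [w]: the coefficients below [c], divided by the
       leading one and pulled back to the line. *)
    assert (Hf : finsupp (fun x => fval w (c - exp (- x)) / fval w c)).
    { destruct (proj2_sig w) as [l Hl]. exists (map (fun d => - ln (c - d)) l).
      intros x Hx. apply in_map_iff. exists (c - exp (- x)). split.
      - replace (c - (c - exp (- x))) with (exp (- x)) by ring. rewrite ln_exp. ring.
      - apply Hl. intro H. change (fval w (c - exp (- x)) = 0) in H. rewrite H in Hx. lra. }
    exists (c, ln (fval w c), exist _ _ Hf). apply fsf_ext. intro d.
    destruct (Rtotal_order d c) as [H|[->|H]].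
    + destruct (below_exp _ _ H) as [x ->].
      change c with (fst (fst (c, ln (fval w c), exist _ _ Hf : Wovs))) at 1.
      rewrite exp0_below. unfold infpart. simpl. rewrite exp_ln by auto. field. lra.
    + pose proof (exp0_lead (c, ln (fval w c), exist _ _ Hf)) as H. simpl fst in H; simpl snd in H. rewrite H. now apply exp_ln.
    + rewrite Hc2 by auto. now apply exp0_above.
  - intros [[c r] f] [[c' r'] f'] H. unfold vlt, vsub in *. simpl in H.
    assert (Hsub : forall d, fval (vadd (exp0 (c', r', f')) (vscal (-1) (exp0 (c, r, f)))) d
                   = fval (exp0 (c', r', f')) d - fval (exp0 (c, r, f)) d).
    { intro d. change fval with (@co Wovs). rewrite co_add, co_scal. ring. }
    pose proof (exp0_lead (c', r', f')) as L'. pose proof (exp0_lead (c, r, f)) as L.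
    pose proof (exp0_above (c', r', f')) as A'. pose proof (exp0_above (c, r, f)) as A.
    pose proof (exp0_below (c', r', f')) as B'. pose proof (exp0_below (c, r, f)) as B.
    unfold infpart in *. simpl fst in *; simpl snd in *.
    destruct H as [H|[H [H1|[H1 [x [Hx1 Hx2]]]]]].
    + exists c'. rewrite Hsub, L', A by lra. split; [generalize (exp_pos r'); lra|].
      intros d Hd. rewrite Hsub, A', A by lra. ring.
    + assert (c' = c) by lra. subst c'. exists c. rewrite Hsub, L', L. split.
      * generalize (exp_increasing r r'). lra.
      * intros d Hd. rewrite Hsub, A', A by lra. ring.
    + assert (c' = c) by lra. subst c'. assert (r' = r) by lra. subst r'.
      change (0 < fval f' x + -1 * fval f x) in Hx1.
      change (forall y, x < y -> fval f' y + -1 * fval f y = 0) in Hx2.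
      exists (c - exp (- x)). rewrite Hsub, B', B. split.
      * replace (exp r * fval f' x - exp r * fval f x) with (exp r * (fval f' x + -1 * fval f x)) by ring.
        apply Rmult_lt_0_compat; [apply exp_pos|auto].
      * intros d Hd. rewrite Hsub. destruct (Rtotal_order d c) as [H2|[->|H2]].
        -- destruct (below_exp _ _ H2) as [y ->]. rewrite B', B.
           assert (Hxy : x < y).
           { destruct (Rlt_le_dec x y) as [|Hle]; auto. exfalso.
             destruct Hle as [Hle| ->]; [|lra].
             generalize (exp_increasing (- x) (- y)). lra. }
           specialize (Hx2 y Hxy). replace (fval f' y) with (fval f y) by lra. ring.
        -- rewrite L', L. ring.
        -- rewrite A', A by lra. ring.
  - intros [[c r] f] a. apply fsf_ext. intro d.
    change (fval (vscal (exp a) (exp0 (c, r, f))) d) with (exp a * fval (exp0 (c, r, f)) d).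
    simpl. unfold exp0_fun, infpart. simpl.
    replace (a * 0 + c) with c by ring. replace (a * 1 + r) with (a + r) by ring. rewrite exp_plus.
    destruct total_order_T as [[H1|H1]|H1]; try ring.
    change (proj1_sig f) with (fval f). destruct Req_EM_T; ring.
  - change (@vone Wovs) with (point 0 1).
    apply fsf_ext. intro d. destruct (Rtotal_order d 0) as [H|[->|H]].
    + rewrite point_off by lra. destruct (below_exp _ _ H) as [x ->].
      pose proof (exp0_below vzero x) as B. simpl fst in B; simpl snd in B. rewrite B.
      unfold infpart. simpl. destruct Req_EM_T; ring.
    + rewrite point_at. pose proof (exp0_lead vzero) as B. simpl fst in B; simpl snd in B. rewrite B. apply exp_0.
    + rewrite point_off by lra. now apply exp0_above.
Qed.

(** * Bumps: moving one point by an infinitesimal *)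

Definition supp_le (d : R) (e : Wovs) : Prop := forall x, d < x -> fval e x = 0.

(** The real part is left free: the neighbourhood is then stable under real translations, and the
    bump commutes with them as [ex_shift] demands. *)
Definition near (c : Vovs) (d : R) (v : Vovs) : Prop :=
  fst (fst v) = fst (fst c) /\ forall x, d < x -> infpart v x = infpart c x.

Definition bump (c : Vovs) (d : R) (e : Wovs) (v : Vovs) : Vovs :=
  if excluded_middle_informative (near c d v) then vadd v (inf e) else v.

Lemma near_inf c d e v : supp_le d e -> (near c d (vadd v (inf e)) <-> near c d v).
Proof.
  intro He. unfold near. simpl. rewrite Rplus_0_r. split; intros [H1 H2]; split; auto; intros x Hx;
    specialize (H2 x Hx); specialize (He x Hx); unfold infpart, fval in *; simpl in *; lra.
Qed.

(** Adding [e] neither enters nor leaves the neighbourhood, so the bump by the opposite of [e]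
    undoes it. *)
Lemma bump_inv c d e v : supp_le d e -> bump c d (vscal (-1) e) (bump c d e v) = v.
Proof.
  intro He. unfold bump at 2. destruct excluded_middle_informative as [H|H].
  - unfold bump. destruct excluded_middle_informative as [H'|H'].
    + apply co_inj. intros [[]|x]; simpl; try ring. unfold fval; simpl. ring.
    + exfalso. apply H'. now apply near_inf.
  - unfold bump. destruct excluded_middle_informative; tauto.
Qed.

Lemma supp_le_neg d e : supp_le d e -> supp_le d (vscal (-1) e).
Proof. intros H x Hx. specialize (H x Hx). unfold fval in *; simpl in *. lra. Qed.

(** Two near points move by the same amount. A near and a distant point with equal class and real
    part are compared at a coordinate above [d], where [e] vanishes. *)
Lemma bump_mono c d e u v : supp_le d e -> vlt u v -> vlt (bump c d e u) (bump c d e v).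
Proof.
  intros He H. unfold bump.
  destruct (excluded_middle_informative (near c d u)) as [[Hu1 Hu2]|Hu];
  destruct (excluded_middle_informative (near c d v)) as [[Hv1 Hv2]|Hv]; auto.
  - now apply vlt_add.
  - destruct u as [[a r] f], v as [[a' r'] f']. unfold vlt, near, infpart in *. simpl in *.
    destruct H as [H|[H [H1|[H1 [x [Hx1 Hx2]]]]]]; [left; lra|right; split; [lra|left; lra]|].
    right. split; [lra|]. right. split; [lra|]. exists x. unfold fval in *; simpl in *.
    assert (Hx : d < x).
    { apply Rnot_le_lt. intro Hx. apply Hv. split; [lra|]. intros y Hy.
      rewrite <- Hu2 by auto. specialize (Hx2 y ltac:(lra)). lra. }
    pose proof (He x Hx). unfold fval in *. split; [lra|]. intros y Hy.
    pose proof (He y ltac:(lra)). specialize (Hx2 y Hy). unfold fval in *. lra.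
  - destruct u as [[a r] f], v as [[a' r'] f']. unfold vlt, near, infpart in *. simpl in *.
    destruct H as [H|[H [H1|[H1 [x [Hx1 Hx2]]]]]]; [left; lra|right; split; [lra|left; lra]|].
    right. split; [lra|]. right. split; [lra|]. exists x. unfold fval in *; simpl in *.
    assert (Hx : d < x).
    { apply Rnot_le_lt. intro Hx. apply Hu. split; [lra|]. intros y Hy.
      rewrite <- Hv2 by auto. specialize (Hx2 y ltac:(lra)). lra. }
    pose proof (He x Hx). unfold fval in *. split; [lra|]. intros y Hy.
    pose proof (He y ltac:(lra)). specialize (Hx2 y Hy). unfold fval in *. lra.
Qed.

Lemma bump_shift c d e a v : bump c d e (vadd (vscal a vone) v) = vadd (vscal a vone) (bump c d e v).
Proof.
  assert (Hn : near c d (vadd (vscal a vone) v) <-> near c d v).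
  { destruct v as [[b r] f]. unfold near, infpart. simpl. replace (a * 0 + b) with b by ring.
    split; intros [H1 H2]; (split; [exact H1|]); intros x Hx; specialize (H2 x Hx); unfold fval in *; simpl in *;
      destruct Req_EM_T; lra. }
  unfold bump. destruct excluded_middle_informative; destruct excluded_middle_informative; try tauto.
  vec_eq.
Qed.

Lemma expo_bump E c d e : expo Wovs Vovs E -> supp_le d e -> bump c d e vzero = vzero ->
  expo Wovs Vovs (fun v => E (bump c d e v)).
Proof.
  intros HE He H0. constructor.
  - intro v. apply (ex_pos _ _ _ HE).
  - intros w Hw. destruct (ex_surj _ _ _ HE w Hw) as [v <-].
    exists (bump c d (vscal (-1) e) v). f_equal.
    replace e with (vscal (-1) (vscal (-1) e)) at 1 by vec_eq. now apply bump_inv, supp_le_neg.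
  - intros u v H. apply (ex_mono _ _ _ HE). now apply bump_mono.
  - intros v a. rewrite bump_shift. apply (ex_shift _ _ _ HE).
  - rewrite H0. apply (ex_zero _ _ _ HE).
Qed.

(** Arbitrarily small changes of a logarithm give its value a fresh coordinate. Asking this at every
    point and for every threshold makes the property survive bumps, so that moves can be
    iterated. *)
Definition rich (E : Vovs -> Wovs) : Prop := forall v d (l : list Wovs),
  exists e, supp_le d e /\ exists x, fval (E (vadd v (inf e))) x <> 0 /\ forall w, In w l -> fval w x = 0.

Lemma below_all (l : list R) : exists m, forall x, In x l -> m < x.
Proof.
  induction l as [|a l [m Hm]].
  - exists 0. intros x [].
  - exists (Rmin m (a - 1)). intros x [<-|Hx].
    + generalize (Rmin_r m (a - 1)). lra.
    + specialize (Hm x Hx). generalize (Rmin_l m (a - 1)). lra.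
Qed.

Lemma below_supp (l : list Wovs) : exists m, forall w x, In w l -> x <= m -> fval w x = 0.
Proof.
  induction l as [|w l [m Hm]].
  - exists 0. intros w x [].
  - destruct (proj2_sig w) as [s Hs]. destruct (below_all s) as [m' Hm'].
    exists (Rmin m m'). intros u x [<-|Hu] Hx.
    + apply NNPP. intro H. apply Hs, Hm' in H. generalize (Rmin_r m m'). lra.
    + apply Hm; auto. generalize (Rmin_l m m'). lra.
Qed.

Lemma rich_exp0 : rich exp0.
Proof.
  intros [[c r] f] d l. destruct (below_supp l) as [m Hm].
  (* [y] lies below the supports of [l], and low enough that its preimage [x] is at most [d]. *)
  set (y := Rmin m (c - exp (- d))).
  assert (Hy1 : y <= m) by apply Rmin_l. assert (Hy2 : y <= c - exp (- d)) by apply Rmin_r.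
  destruct (below_exp c y) as [x Hx]; [generalize (exp_pos (- d)); lra|].
  assert (Hxd : x <= d).
  { apply Rnot_lt_le. intro H. generalize (exp_increasing (- x) (- d)). lra. }
  (* Whatever [f] is at [x], the sum of [f] and [e] is 1 there. *)
  set (e := point x (1 - fval f x) : Wovs). exists e. split.
  - intros z Hz. apply point_off. lra.
  - exists y. split; [|intros; apply Hm; auto].
    assert (B := exp0_below (vadd ((c, r, f) : Vovs) (inf e)) x).
    replace (infpart _ x) with 1 in B.
    + simpl fst in B. simpl snd in B. replace (c + 0 - exp (- x)) with y in B by lra.
      rewrite B. generalize (exp_pos (r + 0)). lra.
    + unfold infpart. simpl. unfold fval at 1. simpl. destruct Req_EM_T; [|congruence].
      unfold fval. ring.
Qed.

Lemma rich_bump E c d e : rich E -> supp_le d e -> rich (fun v => E (bump c d e v)).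
Proof.
  intros HE He v d' l.
  (* Below both thresholds: adding [e'] then does not affect membership in the bumped
     neighbourhood. *)
  destruct (HE (bump c d e v) (Rmin d d') l) as [e' [He' [x Hx]]].
  assert (Hd : supp_le d e') by (intros z Hz; apply He'; generalize (Rmin_l d d'); lra).
  exists e'. split; [intros z Hz; apply He'; generalize (Rmin_r d d'); lra|].
  exists x. replace (bump c d e (vadd v (inf e'))) with (vadd (bump c d e v) (inf e')); auto.
  pose proof (near_inf c d e' v Hd) as Hn. unfold bump.
  destruct excluded_middle_informative; destruct excluded_middle_informative; try tauto. vec_eq.
Qed.

(** That is, [u] and [v] do not differ by a real multiple of [vone], so [ex_shift] does not tie
    their values together. *)
Definition distinct_class (u v : Vovs) : Prop :=
  fst (fst u) <> fst (fst v) \/ exists x, infpart u x <> infpart v x.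

Lemma separate (c : Vovs) (l : list Vovs) : (forall v, In v l -> distinct_class v c) ->
  exists d, forall v, In v l -> ~ near c d v.
Proof.
  induction l as [|u l IH]; intro H.
  - exists 0. intros v [].
  - destruct IH as [d Hd]; [intros; apply H; now right|].
    destruct (H u (or_introl eq_refl)) as [Hu|[x Hx]].
    + exists d. intros v [<-|Hv]; [intros [H1 _]; contradiction|auto].
    (* A point near [c] agrees with [c] strictly above the threshold; [x - 1] makes this include
       [x]. *)
    + exists (Rmin d (x - 1)). intros v [<-|Hv].
      * intros [_ H1]. apply Hx, H1. generalize (Rmin_r d (x - 1)). lra.
      * intros [H1 H2]. apply (Hd v Hv). split; auto. intros z Hz. apply H2.
        generalize (Rmin_l d (x - 1)). lra.
Qed.

Lemma bump_far c d e v : ~ near c d v -> bump c d e v = v.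
Proof. intro H. unfold bump. destruct excluded_middle_informative; tauto. Qed.

Lemma bump_center c d e : bump c d e c = vadd c (inf e).
Proof. unfold bump. destruct excluded_middle_informative as [|H]; auto. exfalso. apply H. split; auto. Qed.

(** For a given logarithm [c]: a bump centred at [c] changes its value only within a neighbourhood
    avoiding [P]. The presence of [vzero] in [P] keeps the value of 1. *)
Lemma move_value E (c : Vovs) (P : list Vovs) (l : list Wovs) :
  expo Wovs Vovs E -> rich E -> In vzero P -> (forall v, In v P -> distinct_class v c) ->
  exists E', expo Wovs Vovs E' /\ rich E' /\ (forall v, In v P -> E' v = E v) /\
    exists x, fval (E' c) x <> 0 /\ forall w, In w l -> fval w x = 0.
Proof.
  intros HE HR H0 HP. destruct (separate c P HP) as [d Hd].
  destruct (HR c d l) as [e [He [x Hx]]].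
  exists (fun v => E (bump c d e v)). split; [|split; [|split]].
  - apply expo_bump; auto. apply bump_far; auto.
  - now apply rich_bump.
  - intros v Hv. now rewrite bump_far by auto.
  - exists x. rewrite bump_center. exact Hx.
Qed.

(** The dual move, for a given value [E c]: precomposing with the inverse bump keeps this value but
    shifts its logarithm by [e]. *)
Lemma move_log E (c : Vovs) (P : list Vovs) :
  expo Wovs Vovs E -> rich E -> In vzero P -> (forall v, In v P -> distinct_class v c) ->
  exists E' c', expo Wovs Vovs E' /\ rich E' /\ (forall v, In v P -> E' v = E v) /\ E' c' = E c /\
    exists x, infpart c' x <> 0 /\ forall v, In v P -> infpart v x = 0.
Proof.
  intros HE HR H0 HP. destruct (separate c P HP) as [d Hd].
  destruct (below_supp (map snd P)) as [m Hm].
  set (x := Rmin m d). assert (Hx1 : x <= m) by apply Rmin_l. assert (Hx2 : x <= d) by apply Rmin_r.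
  (* The new logarithm has coefficient 1 at [x], a point below all infinitesimal parts in [P]. *)
  set (e := point x (1 - infpart c x) : Wovs).
  assert (He : supp_le d e) by (intros z Hz; apply point_off; lra).
  exists (fun v => E (bump c d (vscal (-1) e) v)), (vadd c (inf e)).
  split; [|split; [|split; [|split]]].
  - apply expo_bump; auto using supp_le_neg. apply bump_far; auto.
  - apply rich_bump; auto using supp_le_neg.
  - intros v Hv. now rewrite bump_far by auto.
  - rewrite <- (bump_center c d e). now rewrite bump_inv.
  - exists x. split.
    + assert (Hc : infpart (vadd c (inf e)) x = infpart c x + fval e x) by reflexivity.
      rewrite Hc. unfold e. rewrite point_at. lra.
    + intros v Hv. apply Hm; auto. now apply in_map.
Qed.

(** * The order of normal forms *)

(** Repeated keys are summed, which makes the coefficient additive under concatenation; linear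
    relations are later written as concatenated lists. *)
Fixpoint coef (l : list (R * pre)) (u : pre) : R :=
  match l with
  | [] => 0
  | (a, v) :: r => (if excluded_middle_informative (v = u) then a else 0) + coef r u
  end.

(** Exponents are made real so that products and sums share one theory of coefficients and
    independence. *)
Definition real_exps (l : list (pre * Z)) : list (R * pre) := map (fun p => (IZR (snd p), fst p)) l.

Lemma keys_real_exps l : map snd (real_exps l) = map fst l.
Proof. unfold real_exps. rewrite map_map. reflexivity. Qed.

Lemma coef_out l u : ~ In u (map snd l) -> coef l u = 0.
Proof.
  induction l as [|[a v] l IH]; simpl; auto. intro H.
  destruct excluded_middle_informative; [tauto|]. rewrite IH by tauto. ring.
Qed.

Lemma coef_in l a u : NoDup (map snd l) -> In (a, u) l -> coef l u = a.
Proof.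
  induction l as [|[b v] l IH]; simpl; [tauto|]. intros Hl [H|H]; inversion Hl; subst.
  - injection H as -> ->. destruct excluded_middle_informative; [|tauto]. rewrite coef_out by auto. ring.
  - destruct excluded_middle_informative as [->|].
    + exfalso. apply H2. apply in_map_iff. now exists (a, u).
    + rewrite IH by auto. ring.
Qed.

Lemma in_keys (l : list (R * pre)) u : In u (map snd l) -> exists a, In (a, u) l.
Proof. intro H. apply in_map_iff in H. destruct H as [[a v] [<- H]]. eauto. Qed.

Lemma hascoef_coef l u a : NoDup (map snd l) -> (hascoef l u a <-> a = coef l u).
Proof.
  intro Hl. split.
  - intros [H|[-> H]].
    + symmetry. now apply coef_in.
    + symmetry. apply coef_out. intro Hu. apply in_keys in Hu. destruct Hu as [b Hb]. eapply H, Hb.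
  - intros ->. destruct (classic (In u (map snd l))) as [H|H].
    + left. destruct (in_keys _ _ H) as [a Ha]. now rewrite (coef_in l a u).
    + right. split; [now apply coef_out|]. intros b Hb. apply H. apply in_map_iff. now exists (b, u).
Qed.

Lemma hasexp_hascoef l u i : hasexp l u i <-> hascoef (real_exps l) u (IZR i).
Proof.
  assert (Hin : forall j, In (IZR j, u) (real_exps l) <-> In (u, j) l).
  { intro j. unfold real_exps. rewrite in_map_iff. split.
    - intros [[v k] [Hk H]]. simpl in Hk. injection Hk as Hk ->. apply eq_IZR in Hk. now subst.
    - intro H. now exists (u, j). }
  unfold hasexp, hascoef. rewrite Hin. split; intros [H|[H1 H2]]; auto; right.
  - subst. split; auto. intros b Hb. unfold real_exps in Hb. apply in_map_iff in Hb.
    destruct Hb as [[v k] [Hk H]]. simpl in Hk. injection Hk as Hk ->. eapply H2, H.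
  - split; [now apply eq_IZR|]. intros j Hj. apply (H2 (IZR j)). now apply Hin.
Qed.

Lemma hasexp_coef l u i : NoDup (map fst l) -> (hasexp l u i <-> IZR i = coef (real_exps l) u).
Proof. intro H. rewrite hasexp_hascoef. apply hascoef_coef. now rewrite keys_real_exps. Qed.

Lemma hasexp_total l u : exists i, hasexp l u i.
Proof.
  destruct (classic (exists i, In (u, i) l)) as [[i H]|H].
  - exists i. now left.
  - exists 0%Z. right. split; auto. intros j Hj. apply H. eauto.
Qed.

Lemma coef_list l : NoDup (map snd l) -> l = map (fun u => (coef l u, u)) (map snd l).
Proof.
  intro Hl. rewrite map_map. rewrite <- (map_id l) at 1. apply map_ext_in.
  intros [a u] H. simpl. now rewrite (coef_in l a u).
Qed.

(** * Strict total orders and lexicographic comparison *)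

Record strict_total (D : pre -> Prop) (lt : pre -> pre -> Prop) : Prop := {
  st_irr : forall x, D x -> ~ lt x x;
  st_trans : forall x y z, D x -> D y -> D z -> lt x y -> lt y z -> lt x z;
  st_total : forall x y, D x -> D y -> x = y \/ lt x y \/ lt y x }.

Lemma strict_total_max D lt l : strict_total D lt -> (forall x, In x l -> D x) -> l <> [] ->
  exists m, In m l /\ forall x, In x l -> x = m \/ lt x m.
Proof.
  intros [_ Ht Htot]. induction l as [|a l IH]; [congruence|]. intros HD _.
  destruct l as [|b l].
  - exists a; split; [now left|]. intros x [->|[]]; now left.
  - destruct IH as [m [Hm1 Hm2]]; [intros; apply HD; now right|congruence|].
    assert (Dm : D m) by (apply HD; now right). assert (Da : D a) by (apply HD; now left).
    destruct (Htot a m Da Dm) as [->|[H|H]].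
    + exists m; split; [now left|]. intros x [->|Hx]; auto.
    + exists m; split; [now right|]. intros x [->|Hx]; auto.
    + exists a; split; [now left|]. intros x [->|Hx]; [now left|]. right.
      destruct (Hm2 _ Hx) as [->|Hx']; auto. apply (Ht x m a); auto. apply HD. now right.
Qed.

Definition lexlt (D : pre -> Prop) (lt : pre -> pre -> Prop) (c c' : pre -> R) : Prop :=
  exists u, D u /\ c u < c' u /\ forall v, D v -> lt u v -> c v = c' v.

Lemma lexlt_irr D lt c : ~ lexlt D lt c c.
Proof. intros [u [_ [H _]]]. lra. Qed.

Lemma lexlt_trans D lt c1 c2 c3 : strict_total D lt ->
  lexlt D lt c1 c2 -> lexlt D lt c2 c3 -> lexlt D lt c1 c3.
Proof.
  intros [_ Ht Htot] [u [Du [Hu1 Hu2]]] [v [Dv [Hv1 Hv2]]].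
  destruct (Htot u v Du Dv) as [->|[H|H]].
  - exists v. split; auto. split; [lra|]. intros w Dw Hw. rewrite Hu2; auto.
  - exists v. split; auto. split; [rewrite Hu2; auto|]. intros w Dw Hw. rewrite Hu2; eauto.
  - exists u. split; auto. split; [rewrite <- Hv2; auto|]. intros w Dw Hw. rewrite Hu2; eauto.
Qed.

(** The functions differ at finitely many keys, and the greatest of these decides. *)
Lemma lexlt_total D lt c c' l : strict_total D lt -> (forall u, c u <> c' u -> In u l /\ D u) ->
  (forall u, c u = c' u) \/ lexlt D lt c c' \/ lexlt D lt c' c.
Proof.
  intros HD Hl.
  destruct (classic (forall u, c u = c' u)) as [H|H]; auto. right.
  set (m := filter (fun u => if Req_EM_T (c u) (c' u) then false else true) l).
  assert (Hm : forall u, In u m <-> c u <> c' u).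
  { intro u. unfold m. rewrite filter_In. destruct Req_EM_T; split; try tauto; try easy.
    intro H'. split; auto. now apply Hl. }
  destruct (strict_total_max D lt m HD) as [u [Hu1 Hu2]].
  - intros u Hu. apply Hl, Hm, Hu.
  - intro Hm0. apply H. intro u. apply NNPP. intro Hu. apply Hm in Hu. now rewrite Hm0 in Hu.
  - assert (Du : D u) by apply Hl, Hm, Hu1.
    assert (Heq : forall v, D v -> lt u v -> c v = c' v).
    { intros v Dv Hv. apply NNPP. intro H'. apply Hm, Hu2 in H'. destruct H' as [->|H'].
      - now apply (st_irr _ _ HD u).
      - apply (st_irr _ _ HD u Du). eapply (st_trans _ _ HD u v u); auto. }
    apply Hm in Hu1. destruct (Rtotal_order (c u) (c' u)) as [H1|[H1|H1]]; [left|contradiction|right];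
      exists u; repeat split; auto. intros. symmetry. auto.
Qed.

(** A lexicographic order is pulled back along an injective map to finitely supported coefficient
    functions. *)
Lemma strict_total_transfer D D' lt lt' (c : pre -> pre -> R) (k : pre -> list pre) :
  strict_total D' lt' ->
  (forall s u, D s -> c s u <> 0 -> In u (k s) /\ D' u) ->
  (forall s t, D s -> D t -> (forall u, c s u = c t u) -> s = t) ->
  (forall s t, D s -> D t -> (lt s t <-> lexlt D' lt' (c s) (c t))) ->
  strict_total D lt.
Proof.
  intros HD' Hk Hinj Hlt. constructor.
  - intros x Dx H. apply Hlt in H; auto. now apply lexlt_irr in H.
  - intros x y z Dx Dy Dz H1 H2. apply Hlt in H1, H2; auto. apply Hlt; auto.
    eapply lexlt_trans; eauto.
  - intros x y Dx Dy. rewrite !Hlt by auto.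
    destruct (lexlt_total D' lt' (c x) (c y) (k x ++ k y) HD') as [H|H]; auto.
    intros u Hu. rewrite in_app_iff.
    destruct (Req_dec (c x u) 0) as [H0|H0].
    + destruct (Hk y u) as [H1 H2]; auto. lra.
    + destruct (Hk x u) as [H1 H2]; auto.
Qed.

(** Off the keys both coefficients vanish, so [P] and [lt] need only agree on the keys. This absorbs
    the passage from [ltn] at a fixed level to [prec]. *)
Lemma add_lt_lexlt D P lt ls l :
  NoDup (map snd ls) -> NoDup (map snd l) ->
  (forall u, In u (map snd ls) \/ In u (map snd l) -> D u) ->
  (forall u v, In u (map snd ls) \/ In u (map snd l) -> In v (map snd ls) \/ In v (map snd l) ->
     (P u v <-> lt u v)) ->
  (add_lt P ls l <-> lexlt D lt (coef ls) (coef l)).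
Proof.
  intros N1 N2 HD HP.
  assert (Hk : forall u, coef ls u <> coef l u -> In u (map snd ls) \/ In u (map snd l)).
  { intros u Hu. apply NNPP. intro H. apply Hu. rewrite !coef_out; tauto. }
  split.
  - intros (u & a & b & Ha & Hb & Hab & H). rewrite hascoef_coef in Ha, Hb by auto. subst.
    assert (Ku : In u (map snd ls) \/ In u (map snd l)) by (apply Hk; lra).
    exists u. split; auto. split; auto. intros v Dv Hv.
    apply NNPP. intro Hne. apply Hne. apply (H v); [apply HP; auto| |]; now apply hascoef_coef.
  - intros (u & Du & Hu & H). exists u, (coef ls u), (coef l u).
    assert (Ku : In u (map snd ls) \/ In u (map snd l)) by (apply Hk; lra).
    rewrite !hascoef_coef by auto. repeat split; auto.
    intros v Hv a b Ha Hb. rewrite hascoef_coef in Ha, Hb by auto. subst.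
    apply NNPP. intro Hne. apply Hne. apply H; [apply HD; auto|]. apply HP; auto.
Qed.

(* The order in which exponents are compared: from the largest factor above 1 down to 1, then from the smallest factor up to 1. *)
Definition mlt (lt : pre -> pre -> Prop) (u v : pre) : Prop :=
  (lt POne v /\ lt u v) \/ (lt u POne /\ lt v u).

(** Raising the exponent of a factor below 1 makes a product smaller; the sign change turns [mul_lt]
    into a plain lexicographic order. *)
Definition mcoef (lt : pre -> pre -> Prop) (c : pre -> R) (u : pre) : R :=
  if excluded_middle_informative (lt POne u) then c u else - c u.

Lemma mcoef_eq lt c c' u : mcoef lt c u = mcoef lt c' u <-> c u = c' u.
Proof. unfold mcoef. destruct excluded_middle_informative; split; intros; lra. Qed.

Lemma strict_total_mlt D lt : strict_total D lt -> D POne ->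
  strict_total (fun u => D u /\ u <> POne) (mlt lt).
Proof.
  intros [Hi Ht Htot] H1.
  assert (Ha : forall x y, D x -> D y -> lt x y -> lt y x -> False) by (intros; eapply (Hi x); eauto).
  constructor.
  - intros x [Dx Nx] [[_ H]|[_ H]]; now apply Hi in H.
  - intros x y z [Dx Nx] [Dy Ny] [Dz Nz] [[A1 A2]|[A1 A2]] [[B1 B2]|[B1 B2]].
    + left. eauto.
    + exfalso. eapply (Ha y POne); eauto.
    + left. split; auto. apply (Ht x POne z); auto.
    + right. eauto.
  - intros x y [Dx Nx] [Dy Ny].
    destruct (Htot x y Dx Dy) as [->|H]; auto. right. unfold mlt.
    destruct (Htot x POne Dx H1) as [|[Hx|Hx]]; [tauto| |];
    destruct (Htot y POne Dy H1) as [|[Hy|Hy]]; try tauto.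
Qed.

(** The two disjuncts of [mul_lt] are the two positions of the deciding factor relative to 1. *)
Lemma mul_lt_lexlt D P lt ls l : strict_total D lt -> D POne ->
  NoDup (map fst ls) -> NoDup (map fst l) ->
  let key u := In u (map fst ls) \/ In u (map fst l) in
  (forall u, key u -> D u /\ u <> POne) ->
  (forall u v, key u \/ u = POne -> key v \/ v = POne -> (P u v <-> lt u v)) ->
  (mul_lt P ls l <-> lexlt (fun u => D u /\ u <> POne) (mlt lt)
                       (mcoef lt (coef (real_exps ls))) (mcoef lt (coef (real_exps l)))).
Proof.
  intros HS D1 N1 N2 key HD HP. destruct HS as [Hi Ht Htot].
  assert (Ha : forall x y, D x -> D y -> lt x y -> lt y x -> False) by (intros; eapply (Hi x); eauto).
  set (c := coef (real_exps ls)). set (c' := coef (real_exps l)).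
  assert (Hk : forall u, c u <> c' u -> key u).
  { intros u Hu. apply NNPP. intro H. apply Hu. unfold c, c'.
    rewrite !coef_out; auto; rewrite keys_real_exps; unfold key in H; tauto. }
  assert (Hx : forall u i j, hasexp ls u i -> hasexp l u j -> IZR i = c u /\ IZR j = c' u).
  { intros u i j Hu Hj. now rewrite hasexp_coef in Hu, Hj by auto. }
  assert (Hall : forall Q : pre -> Prop,
     (forall v, Q v -> forall i j, hasexp ls v i -> hasexp l v j -> i = j) <-> (forall v, Q v -> c v = c' v)).
  { intro Q. split; intros H v Qv.
    - destruct (hasexp_total ls v) as [i Hv1], (hasexp_total l v) as [j Hv2].
      destruct (Hx _ _ _ Hv1 Hv2) as [<- <-]. f_equal. eauto.
    - intros i j Hv1 Hv2. destruct (Hx _ _ _ Hv1 Hv2) as [E1 E2]. apply eq_IZR. rewrite E1, E2. auto. }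
  unfold mul_lt. split.
  - intros [(u & i & j & H1u & Hui & Huj & Hij & H)|(Hup & u & i & j & H1u & Hui & Huj & Hij & H)];
      (pose proof (proj1 (Hall (fun v => P u v)) H) as H0 || pose proof (proj1 (Hall (fun v => P v u)) H) as H0); clear H; rename H0 into H;
      destruct (Hx _ _ _ Hui Huj) as [E1 E2]; apply IZR_lt in Hij; rewrite E1, E2 in Hij;
      (assert (Ku : key u) by (apply Hk; lra)); destruct (HD u Ku) as [Du Nu]; exists u; (split; [auto|]);
      apply HP in H1u; auto.
    + split.
      * unfold mcoef. destruct excluded_middle_informative; tauto.
      * intros v [Dv Nv] Hv. apply mcoef_eq. apply NNPP. intro Hne.
        apply Hne, H, HP; auto.
        destruct Hv as [[_ Hv]|[Hv _]]; auto. exfalso. apply (Ha u POne); auto.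
    + pose proof (proj1 (Hall (fun v => P POne v)) Hup) as Hup0; clear Hup; rename Hup0 into Hup. split.
      * unfold mcoef. destruct excluded_middle_informative; [|lra]. exfalso. apply (Ha u POne); auto.
      * intros v [Dv Nv] Hv. apply mcoef_eq. apply NNPP. intro Hne.
        destruct Hv as [[Hv _]|[_ Hv]]; apply Hne; [apply Hup|apply H]; apply HP; auto.
  - intros (u & [Du Nu] & Hu & H).
    assert (Ku : key u).
    { apply Hk. intro E. apply (mcoef_eq lt) in E. unfold c, c' in *. lra. }
    destruct (hasexp_total ls u) as [i Hui], (hasexp_total l u) as [j Huj].
    destruct (Hx _ _ _ Hui Huj) as [E1 E2].
    unfold mcoef in Hu. fold c c' in Hu. destruct excluded_middle_informative as [Hlu|Hlu].
    + left. exists u, i, j. rewrite <- E1, <- E2 in Hu. apply lt_IZR in Hu.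
      repeat split; auto. { apply HP; auto. }
      apply (proj2 (Hall (fun v => P u v))). intros v Hv. apply NNPP. intro Hne.
      destruct (HD v (Hk v Hne)) as [Dv Nv]. apply HP in Hv; auto. apply Hne.
      apply (mcoef_eq lt). apply H; auto. left. split; auto. apply (Ht POne u v); auto.
    + right. assert (Hul : lt u POne) by (destruct (Htot u POne) as [|[|]]; tauto). split.
      * apply (proj2 (Hall (fun v => P POne v))). intros v Hv. apply NNPP. intro Hne.
        destruct (HD v (Hk v Hne)) as [Dv Nv]. apply HP in Hv; auto. apply Hne.
        apply (mcoef_eq lt). apply H; auto. left. split; auto. apply (Ht u POne v); auto.
      * assert (Hji : IZR j < IZR i) by lra. apply lt_IZR in Hji.
        exists u, i, j. repeat split; auto. { apply HP; auto. }
        apply (proj2 (Hall (fun v => P v u))). intros v Hv. apply NNPP. intro Hne.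
        destruct (HD v (Hk v Hne)) as [Dv Nv]. apply HP in Hv; auto. apply Hne.
        apply (mcoef_eq lt). apply H; auto. right. auto.
Qed.

(** * Ranks, sorted lists and uniqueness of components *)

Lemma maxl_le l n : In n l -> (n <= maxl l)%nat.
Proof. induction l as [|m l IH]; simpl; [tauto|]. intros [->|H]; [lia|]. specialize (IH H). lia. Qed.

Lemma rank_add l : rank (PAdd l) = S (maxl (map rank (map snd l))).
Proof. simpl. do 2 f_equal. induction l as [|[a u] l IH]; simpl; congruence. Qed.

Lemma rank_mul l : rank (PMul l) =
  let m := maxl (map rank (map fst l)) in if Nat.eqb m 0 then 2%nat else S m.
Proof.
  simpl.
  assert (H : (fix rs (l : list (pre * Z)) : list nat :=
            match l with [] => [] | (u, _) :: r => rank u :: rs r end) l = map rank (map fst l)).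
  { induction l as [|[u i] l IH]; simpl; congruence. }
  now rewrite H.
Qed.

Lemma rank_add_comp l u : In u (map snd l) -> (rank u < rank (PAdd l))%nat.
Proof. intro H. rewrite rank_add. apply (in_map rank), maxl_le in H. lia. Qed.

Lemma rank_mul_fac l u : In u (map fst l) -> (rank u < rank (PMul l))%nat.
Proof.
  intro H. rewrite rank_mul. apply (in_map rank), maxl_le in H. simpl.
  destruct Nat.eqb eqn:E; [apply Nat.eqb_eq in E|]; lia.
Qed.

Lemma nf_add F l : nf_pre F (PAdd l) ->
  (2 <= length l)%nat /\ (forall a u, In (a, u) l -> a <> 0 /\ not_additive u /\ nf_pre F u) /\
  decreasing (map snd l) /\ exists u r, l = (1, u) :: r.
Proof.
  intros (H1 & H2 & H3 & H4 & H5). split; [auto|]. split; [|split; [auto|]].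
  - intros a u Hu. destruct (H2 a u Hu) as (_ & Ha & Hn). split; auto. split; auto.
    clear - H3 Hu. induction l as [|[b v] l IH]; [destruct Hu|]. destruct H3 as [Hv H3].
    destruct Hu as [Hu|Hu]; auto. injection Hu as -> ->. auto.
  - destruct l as [|[a u] l]; [tauto|]. subst. eauto.
Qed.

Lemma nf_mul F l : nf_pre F (PMul l) ->
  ((2 <= length l)%nat \/ exists u i, l = [(u, i)] /\ i <> 1%Z) /\
  (forall u i, In (u, i) l -> i <> 0%Z /\ not_multiplicative u /\ not_one u /\ nf_pre F u) /\
  decreasing (map fst l).
Proof.
  intros (H1 & H2 & H3 & H4). split; [auto|]. split; [|auto].
  intros u i Hu. destruct (H2 u i Hu) as (Ha & Hn & Ho). repeat split; auto.
  clear - H3 Hu. induction l as [|[v b] l IH]; [destruct Hu|]. destruct H3 as [Hv H3].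
  destruct Hu as [Hu|Hu]; auto. injection Hu as -> ->. auto.
Qed.

Lemma maxl_even l : (forall n, In n l -> Nat.even n = true) -> Nat.even (maxl l) = true.
Proof.
  induction l as [|n l IH]; simpl; auto. intro H.
  destruct (Nat.max_spec n (maxl l)) as [[_ ->]|[_ ->]]; auto.
Qed.

Lemma maxl_odd l : (forall n, In n l -> n = 0%nat \/ Nat.odd n = true) -> maxl l = 0%nat \/ Nat.odd (maxl l) = true.
Proof.
  induction l as [|n l IH]; simpl; auto. intro H.
  destruct (Nat.max_spec n (maxl l)) as [[_ ->]|[_ ->]]; auto.
Qed.

(** Sums and products alternate along subterms. Two preterms of one kind, not both of rank 0, are
    therefore compared by the clause of [ltn] for that kind. *)
Lemma rank_parity F p : nf_pre F p ->
  (not_additive p -> Nat.even (rank p) = true) /\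
  (not_multiplicative p -> rank p = 0%nat \/ Nat.odd (rank p) = true).
Proof.
  remember (rank p) as n eqn:Hn. revert p Hn.
  induction n as [n IH] using (well_founded_induction lt_wf). intros p -> Hp.
  destruct p as [i| |l|l]; [simpl; auto|simpl; auto| |].
  - split; [intros []|]. intros _. right. destruct (nf_add _ _ Hp) as (_ & H & _ & _).
    assert (E : Nat.even (maxl (map rank (map snd l))) = true).
    { apply maxl_even. intros n Hn. apply in_map_iff in Hn. destruct Hn as [u [<- Hu]].
      destruct (in_keys _ _ Hu) as [a Ha]. destruct (H _ _ Ha) as (_ & H1 & H2).
      eapply IH; eauto. now apply rank_add_comp. }
    rewrite rank_add, Nat.odd_succ. exact E.
  - split; [|intros []]. intros _. destruct (nf_mul _ _ Hp) as (_ & H & _).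
    assert (E : maxl (map rank (map fst l)) = 0%nat \/ Nat.odd (maxl (map rank (map fst l))) = true).
    { apply maxl_odd. intros n Hn. apply in_map_iff in Hn. destruct Hn as [u [<- Hu]].
      pose proof (rank_mul_fac _ _ Hu) as Hr.
      apply in_map_iff in Hu. destruct Hu as [[v i] [<- Hu]].
      destruct (H _ _ Hu) as (_ & H1 & _ & H2). eapply IH; eauto. }
    rewrite rank_mul. cbv zeta. destruct Nat.eqb eqn:E0; auto.
    rewrite Nat.even_succ. destruct E as [E|E]; auto. rewrite E in E0. discriminate.
Qed.

Lemma ltn_prec n u v : (rank u <= n)%nat -> (rank v <= n)%nat -> (ltn n u v <-> prec u v).
Proof.
  intros Hu Hv. induction n as [|n IH].
  - unfold prec. replace (Nat.max (rank u) (rank v)) with 0%nat by lia. tauto.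
  - destruct (Nat.le_gt_cases (Nat.max (rank u) (rank v)) n) as [H|H].
    + simpl. rewrite (proj2 (Nat.leb_le (rank u) n)), (proj2 (Nat.leb_le (rank v) n)) by lia.
      simpl. apply IH; lia.
    + unfold prec. replace (Nat.max (rank u) (rank v)) with (S n) by lia. tauto.
Qed.

Lemma prec_succ n s t : Nat.max (rank s) (rank t) = S n ->
  prec s t <-> if Nat.odd (S n) then add_lt (ltn n) (addcomps s) (addcomps t)
               else mul_lt (ltn n) (mulfacs s) (mulfacs t).
Proof.
  intro H. unfold prec. rewrite H. cbn [ltn].
  replace (Nat.leb (rank s) n && Nat.leb (rank t) n)%bool with false.
  - replace (Nat.leb (rank s) (S n) && Nat.leb (rank t) (S n))%bool with true; [tauto|].
    symmetry. rewrite Bool.andb_true_iff, !Nat.leb_le. lia.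
  - symmetry. rewrite Bool.andb_false_iff, !Nat.leb_gt. lia.
Qed.

(** [decreasing] compares neighbours only; transitivity on [D] extends this to all pairs. *)
Lemma decreasing_sorted D l : strict_total D prec -> (forall x, In x l -> D x) -> decreasing l ->
  StronglySorted (fun x y => prec y x) l.
Proof.
  intros HD. induction l as [|x l IH]; intros Hl Hd; [constructor|].
  destruct l as [|y l]; [constructor; constructor|]. destruct Hd as [Hyx Hd].
  assert (Hs : StronglySorted (fun x y => prec y x) (y :: l)) by (apply IH; auto; intros; apply Hl; now right).
  constructor; auto. constructor; auto. inversion Hs; subst.
  rewrite Forall_forall in *. intros z Hz.
  apply (st_trans _ _ HD z y x); auto; apply Hl; simpl; auto.
Qed.

Lemma decreasing_NoDup D l : strict_total D prec -> (forall x, In x l -> D x) -> decreasing l -> NoDup l.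
Proof.
  intros HD Hl Hd. pose proof (decreasing_sorted D l HD Hl Hd) as Hs. clear Hd.
  induction Hs as [|x l Hs IH Hx]; constructor.
  - rewrite Forall_forall in Hx. intro H. apply Hx in H. apply (st_irr _ _ HD x) in H; auto. apply Hl; now left.
  - apply IH. intros; apply Hl; now right.
Qed.

Lemma decreasing_unique D l l' : strict_total D prec -> (forall x, In x l -> D x) ->
  decreasing l -> decreasing l' -> (forall x, In x l <-> In x l') -> l = l'.
Proof.
  intros HD Hl Hd Hd' He.
  assert (Hl' : forall x, In x l' -> D x) by (intros; apply Hl, He; auto).
  pose proof (decreasing_sorted D l HD Hl Hd) as Hs.
  pose proof (decreasing_sorted D l' HD Hl' Hd') as Hs'. clear Hd Hd'.
  revert l' Hl' Hs' He. induction Hs as [|x l Hs IH Hx]; intros l' Hl' Hs' He.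
  - destruct l' as [|y l']; auto. exfalso. apply (He y). now left.
  - destruct Hs' as [|y l' Hs' Hy]; [exfalso; apply (He x); now left|].
    rewrite Forall_forall in Hx, Hy.
    assert (Dx : D x) by (apply Hl; now left). assert (Dy : D y) by (apply Hl'; now left).
    assert (Hxy : x = y).
    { destruct (proj1 (He x) (or_introl eq_refl)) as [H|H]; auto.
      destruct (proj2 (He y) (or_introl eq_refl)) as [H'|H']; auto.
      exfalso. apply (st_irr _ _ HD x Dx). apply (st_trans _ _ HD x y x); auto. }
    subst y. f_equal. apply IH; auto.
    + intros; apply Hl; now right.
    + intros; apply Hl'; now right.
    + intro z. split; intro Hz.
      * destruct (proj1 (He z) (or_intror Hz)) as [<-|]; auto. exfalso. apply (st_irr _ _ HD x Dx). auto.
      * destruct (proj2 (He z) (or_intror Hz)) as [<-|]; auto. exfalso. apply (st_irr _ _ HD x Dx). auto.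
Qed.

Definition nf_nonmul (F : R -> Prop) (n : nat) (p : pre) : Prop :=
  nf_pre F p /\ not_multiplicative p /\ (rank p <= n)%nat.

Definition nf_nonadd (F : R -> Prop) (n : nat) (p : pre) : Prop :=
  nf_pre F p /\ not_additive p /\ (rank p <= n)%nat.

Lemma addcomps_decreasing F p : nf_pre F p -> decreasing (map snd (addcomps p)).
Proof. destruct p; intro H; simpl; auto. apply (nf_add _ _ H). Qed.

Lemma mulfacs_decreasing F p : nf_pre F p -> decreasing (map fst (mulfacs p)).
Proof. destruct p; intro H; simpl; auto. apply (nf_mul _ _ H). Qed.

Lemma addcomps_nonzero F p a u : nf_pre F p -> In (a, u) (addcomps p) -> a <> 0.
Proof.
  destruct p as [i| |l|l]; intros H Hu; try (destruct Hu as [Hu|[]]; injection Hu as <- <-; lra).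
  now apply (nf_add _ _ H) in Hu.
Qed.

Lemma mulfacs_nonzero F p a u : nf_pre F p -> In (a, u) (real_exps (mulfacs p)) -> a <> 0.
Proof.
  intros H Hu. apply in_map_iff in Hu. destruct Hu as [[v i] [Hi Hu]]. injection Hi as <- ->.
  simpl. intro H0. apply eq_IZR in H0. revert H0.
  destruct p as [j| |l|l]; try (destruct Hu as [Hu|[]]; injection Hu as <- <-; easy); try destruct Hu.
  now apply (nf_mul _ _ H) in Hu.
Qed.

Lemma addcomps_nf F p u : nf_pre F p -> In u (map snd (addcomps p)) -> nf_pre F u /\ not_additive u.
Proof.
  destruct p as [i| |l|l]; intros H Hu; try (destruct Hu as [<-|[]]; simpl; auto; fail).
  apply in_keys in Hu. destruct Hu as [a Hu]. now apply (nf_add _ _ H) in Hu.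
Qed.

Lemma mulfacs_nf F p u : nf_pre F p -> In u (map fst (mulfacs p)) ->
  nf_pre F u /\ not_multiplicative u /\ not_one u.
Proof.
  destruct p as [i| |l|l]; intros H Hu; try (destruct Hu as [<-|[]]; simpl; auto; fail); try destruct Hu.
  apply in_map_iff in Hu. destruct Hu as [[v i] [<- Hu]].
  now apply (nf_mul _ _ H) in Hu.
Qed.

Lemma addcomps_rank p u : In u (map snd (addcomps p)) ->
  (rank u <= rank p)%nat /\ (not_multiplicative p -> rank u <= pred (rank p))%nat.
Proof.
  destruct p as [i| |l|l]; intros Hu; try (destruct Hu as [<-|[]]; split; [apply le_n|]; intro H; destruct H; apply le_n).
  apply (rank_add_comp l) in Hu. split; [|intros _]; lia.
Qed.

Lemma mulfacs_rank p u : In u (map fst (mulfacs p)) ->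
  (rank u <= rank p)%nat /\ (not_additive p -> rank u <= pred (rank p))%nat.
Proof.
  destruct p as [i| |l|l]; intros Hu; try (destruct Hu as [<-|[]]; split; [apply le_n|]; intro H; destruct H; apply le_n); try destruct Hu.
  apply (rank_mul_fac l) in Hu. split; [|intros _]; lia.
Qed.

(** A normal sum has at least two summands, so its list is never the singleton attached to another
    preterm. *)
Lemma addcomps_inj F s t : nf_pre F s -> nf_pre F t -> addcomps s = addcomps t -> s = t.
Proof.
  intros Hs Ht. destruct s as [i| |l|l], t as [j| |m|m]; simpl; try congruence; intros E;
    try (apply nf_add in Ht; destruct Ht as [Ht _]; rewrite <- E in Ht; simpl in Ht; lia);
    apply nf_add in Hs; destruct Hs as [Hs _]; rewrite E in Hs; simpl in Hs; lia.
Qed.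

(** A normal product is nonempty, and a single factor has exponent other than 1; it is confused
    neither with 1 nor with a factor. *)
Lemma mulfacs_inj F s t : nf_pre F s -> nf_pre F t -> mulfacs s = mulfacs t -> s = t.
Proof.
  assert (Hl : forall l p, nf_pre F (PMul l) -> l <> [(p, 1%Z)] /\ l <> []).
  { intros l p H. apply nf_mul in H. destruct H as [[H|(u & i & -> & Hi)] _].
    - destruct l as [|x [|y l]]; simpl in H; try lia. split; congruence.
    - split; congruence. }
  intros Hs Ht. destruct s as [i| |l|l], t as [j| |m|m]; simpl; try congruence; intros E;
    exfalso; match type of E with
    | [(?p, _)] = ?m => destruct (Hl m p Ht); congruence
    | [] = ?m => destruct (Hl m POne Ht); congruence
    | ?m = [(?p, _)] => destruct (Hl m p Hs); congruence
    | ?m = [] => destruct (Hl m POne Hs); congruence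
    end.
Qed.

(** With nonzero entries the keys are the support of [coef], hence equal for both lists, and a set
    has only one decreasing enumeration. *)
Lemma proportional D l l' c : strict_total D prec ->
  (forall u, In u (map snd l) -> D u) -> (forall u, In u (map snd l') -> D u) ->
  decreasing (map snd l) -> decreasing (map snd l') ->
  (forall a u, In (a, u) l -> a <> 0) -> (forall a u, In (a, u) l' -> a <> 0) ->
  c <> 0 -> (forall u, coef l u = c * coef l' u) ->
  l = map (fun p => (c * fst p, snd p)) l'.
Proof.
  intros HD Dl Dl' Hd Hd' Hn Hn' Hc H.
  pose proof (decreasing_NoDup _ _ HD Dl Hd) as N. pose proof (decreasing_NoDup _ _ HD Dl' Hd') as N'.
  assert (Hk : forall m u, NoDup (map snd m) -> (forall a v, In (a, v) m -> a <> 0) ->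
                 (In u (map snd m) <-> coef m u <> 0)).
  { intros m u Nm Hm. split.
    - intro Hu. destruct (in_keys _ _ Hu) as [a Ha]. rewrite (coef_in m a u) by auto. eauto.
    - intro Hu. apply NNPP. intro H0. apply Hu. now apply coef_out. }
  assert (E : map snd l = map snd l').
  { apply (decreasing_unique D); auto. intro u. rewrite !Hk by auto. rewrite H.
    split; intros H1 H2; apply H1; [rewrite H2; ring|].
    apply Rmult_integral in H2. tauto. }
  rewrite (coef_list l N), E. rewrite (coef_list l' N') at 2. rewrite !map_map. apply map_ext.
  intro u. simpl. now rewrite H.
Qed.

(** The two claims are proved together because each order is lexicographic over the other one a
    level below. *)
Lemma strict_total_levels F n :
  strict_total (nf_nonmul F n) prec /\ strict_total (nf_nonadd F n) prec.
Proof.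
  induction n as [|n [IHA IHB]].
  - assert (H0 : forall p, nf_pre F p -> (rank p <= 0)%nat -> p = POne \/ exists i, p = PVar i).
    { intros [i| |l|l] _ H; eauto; exfalso; simpl in H; [lia|]. destruct Nat.eqb; lia. }
    assert (HS : forall D : pre -> Prop, (forall p, D p -> nf_pre F p /\ (rank p <= 0)%nat) -> strict_total D prec).
    { intros D HD.
      assert (H1 : forall p, D p -> p = POne \/ exists i, p = PVar i) by (intros p Hp; apply H0; apply HD, Hp).
      constructor.
      - intros x Dx. destruct (H1 x Dx) as [->|[i ->]]; cbv; [tauto|]. apply Nat.lt_irrefl.
      - intros x y z Dx Dy Dz. destruct (H1 x Dx) as [->|[i ->]], (H1 y Dy) as [->|[j ->]], (H1 z Dz) as [->|[k ->]];
          unfold prec; simpl; try tauto; lia.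
      - intros x y Dx Dy. destruct (H1 x Dx) as [->|[i ->]], (H1 y Dy) as [->|[j ->]];
          unfold prec; simpl; try tauto.
        destruct (Nat.lt_trichotomy i j) as [H|[->|H]]; tauto. }
    split; apply HS; unfold nf_nonmul, nf_nonadd; tauto.
  - assert (DB1 : nf_nonadd F n POne) by (repeat split; simpl; auto; lia).
    assert (DA1 : nf_nonmul F n POne) by (repeat split; simpl; auto; lia).
    assert (KA : forall s, nf_nonmul F (S n) s -> forall u, In u (map snd (addcomps s)) -> nf_nonadd F n u).
    { intros s (Hs & Hm & Hr) u Hu. destruct (addcomps_nf _ _ _ Hs Hu) as [H1 H2].
      apply addcomps_rank in Hu. repeat split; auto. destruct Hu as [_ Hu]. specialize (Hu Hm). lia. }
    assert (KB : forall s, nf_nonadd F (S n) s -> forall u, In u (map fst (mulfacs s)) ->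
                  nf_nonmul F n u /\ u <> POne).
    { intros s (Hs & Hm & Hr) u Hu. destruct (mulfacs_nf _ _ _ Hs Hu) as (H1 & H2 & H3).
      apply mulfacs_rank in Hu. repeat split; auto; [|destruct u; simpl in H3; congruence].
      destruct Hu as [_ Hu]. specialize (Hu Hm). lia. }
    assert (NA : forall s, nf_nonmul F (S n) s -> NoDup (map snd (addcomps s))).
    { intros s Hs. apply (decreasing_NoDup (nf_nonadd F n)); [auto|apply (KA s Hs)|].
      apply (addcomps_decreasing F), Hs. }
    assert (NB : forall s, nf_nonadd F (S n) s -> NoDup (map fst (mulfacs s))).
    { intros s Hs. apply (decreasing_NoDup (nf_nonmul F n)); auto.
      - intros u Hu. eapply KB; eauto.
      - apply (mulfacs_decreasing F), Hs. }
    split.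
    + apply (strict_total_transfer _ (nf_nonadd F n) prec prec (fun s => coef (addcomps s))
        (fun s => map snd (addcomps s)) IHB).
      * intros s u Ds Hu.
        assert (Ku : In u (map snd (addcomps s))) by (apply NNPP; intro H; apply Hu; now apply coef_out).
        eauto.
      * intros s t Ds Dt Hst. apply (addcomps_inj F); [apply Ds|apply Dt|].
        rewrite <- (map_id (addcomps t)).
        rewrite (proportional (nf_nonadd F n) (addcomps s) (addcomps t) 1 IHB); eauto.
        -- apply map_ext. intros [a u]. simpl. f_equal. ring.
        -- apply (addcomps_decreasing F), Ds.
        -- apply (addcomps_decreasing F), Dt.
        -- intros a u. apply (addcomps_nonzero F), Ds.
        -- intros a u. apply (addcomps_nonzero F), Dt.
        -- intro u. rewrite Hst. ring.
      * intros s t Ds Dt.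
        (* At rank 0 [prec] is [base_lt] and not a comparison of coefficients. A basic preterm is
           its own only component, so both agree by the order one level below. *)
        destruct (Nat.max (rank s) (rank t)) as [|m] eqn:Hm.
        -- assert (Hb : forall p, nf_nonmul F (S n) p -> rank p = 0%nat -> nf_nonadd F n p /\ addcomps p = [(1, p)]).
           { intros [i| |l|l] (H1 & H2 & H3) H; simpl in *; try tauto; try lia; repeat split; simpl; auto; lia. }
           destruct (Hb s Ds) as [Bs ->]; [lia|]. destruct (Hb t Dt) as [Bt ->]; [lia|].
           assert (Hc : forall p u, coef [(1, p)] u = if excluded_middle_informative (p = u) then 1 else 0).
           { intros p u. simpl. destruct excluded_middle_informative; ring. }
           assert (Hle : forall s t, nf_nonadd F n s -> nf_nonadd F n t -> prec s t ->
                      lexlt (nf_nonadd F n) prec (coef [(1, s)]) (coef [(1, t)])).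
           { clear - IHB Hc. intros s t Ds Dt H. exists t. rewrite !Hc. split; auto.
             destruct (excluded_middle_informative (s = t)) as [->|].
             { now apply (st_irr _ _ IHB) in H. }
             destruct (excluded_middle_informative (t = t)); [|tauto]. split; [lra|].
             intros v Dv Hv. rewrite !Hc.
             destruct (excluded_middle_informative (s = v)) as [->|].
             { exfalso. apply (st_irr _ _ IHB t Dt). apply (st_trans _ _ IHB t v t); auto. }
             destruct (excluded_middle_informative (t = v)) as [->|]; auto.
             now apply (st_irr _ _ IHB) in Hv. }
           split; [apply Hle; auto|]. intro H.
           destruct (st_total _ _ IHB s t Bs Bt) as [->|[H'|H']]; auto.
           ++ now apply lexlt_irr in H.
           ++ apply Hle in H'; auto. exfalso. eapply lexlt_irr, lexlt_trans; eauto.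
        -- rewrite (prec_succ m) by auto.
           assert (Hodd : Nat.odd (S m) = true).
           { destruct Ds as (Hs & Ms & _), Dt as (Ht & Mt & _).
             destruct (rank_parity F s Hs) as [_ Ps], (rank_parity F t Ht) as [_ Pt].
             specialize (Ps Ms). specialize (Pt Mt).
             destruct (Nat.max_spec (rank s) (rank t)) as [[_ E]|[_ E]]; rewrite E in Hm; rewrite <- Hm;
               [destruct Pt as [Pt|]|destruct Ps as [Ps|]]; auto; congruence. }
           rewrite Hodd.
           assert (Hr : forall u, In u (map snd (addcomps s)) \/ In u (map snd (addcomps t)) -> (rank u <= m)%nat).
           { destruct Ds as (Hs & Ms & _), Dt as (Ht & Mt & _).
             intros u [Hu|Hu]; apply addcomps_rank in Hu; destruct Hu as [_ Hu];
               [specialize (Hu Ms)|specialize (Hu Mt)]; lia. }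
           apply add_lt_lexlt; auto.
           ++ intros u [Hu|Hu]; eauto.
           ++ intros u v Hu Hv. apply ltn_prec; auto.
    + apply (strict_total_transfer _ (fun u => nf_nonmul F n u /\ u <> POne) prec (mlt prec)
        (fun s => mcoef prec (coef (real_exps (mulfacs s)))) (fun s => map fst (mulfacs s))).
      * now apply strict_total_mlt.
      * intros s u Ds Hu.
        assert (Ku : In u (map fst (mulfacs s))).
        { apply NNPP; intro H; apply Hu. rewrite <- keys_real_exps in H. unfold mcoef.
          rewrite coef_out by auto. destruct excluded_middle_informative; ring. }
        split; auto. now apply (KB s).
      * intros s t Ds Dt Hst. apply (mulfacs_inj F); [apply Ds|apply Dt|].
        assert (E : real_exps (mulfacs s) = real_exps (mulfacs t)).
        { rewrite <- (map_id (real_exps (mulfacs t))).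
          rewrite (proportional (nf_nonmul F n) (real_exps (mulfacs s)) (real_exps (mulfacs t)) 1 IHA);
            rewrite ?keys_real_exps; eauto.
          -- apply map_ext. intros [a u]. simpl. f_equal. ring.
          -- intros u Hu. now apply (KB s).
          -- intros u Hu. now apply (KB t).
          -- apply (mulfacs_decreasing F), Ds.
          -- apply (mulfacs_decreasing F), Dt.
          -- intros a u. apply (mulfacs_nonzero F), Ds.
          -- intros a u. apply (mulfacs_nonzero F), Dt.
          -- intro u. specialize (Hst u). apply mcoef_eq in Hst. rewrite Hst. ring. }
        revert E. generalize (mulfacs s) (mulfacs t). clear.
        induction l as [|[u i] l IH]; intros [|[v j] m] E; try discriminate; auto.
        injection E as E1 -> E2. apply eq_IZR in E1. subst. f_equal. now apply IH.
      * intros s t Ds Dt.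
        (* At rank 0, 1 has no factors and a variable has itself with exponent 1. Variables lie
           below 1, so [mcoef] is -1 there, and of two variables the one of larger index decides. *)
        destruct (Nat.max (rank s) (rank t)) as [|m] eqn:Hm.
        -- assert (Hb : forall p, nf_nonadd F (S n) p -> rank p = 0%nat -> p = POne \/ exists i, p = PVar i).
           { intros [i| |l|l] (H1 & H2 & H3) H; eauto; exfalso; simpl in H; [lia|]. destruct Nat.eqb; lia. }
           assert (Hc1 : forall u, mcoef prec (coef (real_exps (mulfacs POne))) u = 0).
           { intro u. unfold mcoef. simpl. destruct excluded_middle_informative; ring. }
           assert (Hc : forall i u, mcoef prec (coef (real_exps (mulfacs (PVar i)))) u
                         = if excluded_middle_informative (PVar i = u) then -1 else 0).
           { intros i u. unfold mcoef. simpl. destruct (excluded_middle_informative (PVar i = u)) as [<-|];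
               destruct excluded_middle_informative as [H|H]; try ring. destruct H. }
           assert (Dv : forall i, nf_nonmul F n (PVar i) /\ PVar i <> POne).
           { intro i. repeat split; simpl; auto; try lia. congruence. }
           set (L := lexlt (fun u => nf_nonmul F n u /\ u <> POne) (mlt prec)).
           assert (Hv1 : forall i, L (mcoef prec (coef (real_exps (mulfacs (PVar i)))))
                                     (mcoef prec (coef (real_exps (mulfacs POne))))).
           { intro i. exists (PVar i). split; auto. rewrite Hc, Hc1. split.
             - destruct excluded_middle_informative; [lra|tauto].
             - intros v Dv' Hv. rewrite Hc, Hc1. destruct excluded_middle_informative as [<-|]; auto.
               exfalso. now apply (st_irr _ _ (strict_total_mlt _ _ IHA DA1)) in Hv. }
           assert (Hv2 : forall i j, (j < i)%nat -> L (mcoef prec (coef (real_exps (mulfacs (PVar i)))))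
                                     (mcoef prec (coef (real_exps (mulfacs (PVar j)))))).
           { intros i j Hij. exists (PVar i). split; auto. rewrite !Hc. split.
             - destruct (excluded_middle_informative (PVar i = PVar i)); [|tauto].
               destruct excluded_middle_informative as [E|]; [|lra]. injection E. lia.
             - intros v Dv' Hv. rewrite !Hc. destruct excluded_middle_informative as [<-|].
               { exfalso. now apply (st_irr _ _ (strict_total_mlt _ _ IHA DA1)) in Hv. }
               destruct excluded_middle_informative as [<-|]; auto.
               exfalso. destruct Hv as [[[] _]|[_ Hv]]. cbv in Hv. unfold lt in *. lia. }
           assert (Htr : forall x y z, L x y -> L y z -> L x z).
           { intros x y z. apply lexlt_trans. now apply strict_total_mlt. }
           assert (Hir : forall x, ~ L x x) by (intro; apply lexlt_irr).
           fold L.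
           destruct (Hb s Ds) as [->|[i ->]], (Hb t Dt) as [->|[j ->]]; try lia.
           ++ split; [intros []|]. intro H. now apply Hir in H.
           ++ split; [intros []|]. intro H. exfalso. eapply Hir, Htr; [apply H|apply Hv1].
           ++ split; [intros _; apply Hv1|]. intros _. exact I.
           ++ change (prec (PVar i) (PVar j)) with (j < i)%nat. split; [apply Hv2|]. intro H.
              destruct (Nat.lt_trichotomy i j) as [H'|[->|H']]; auto; exfalso.
              ** eapply Hir, Htr; [apply H|apply Hv2, H'].
              ** now apply Hir in H.
        -- rewrite (prec_succ m) by auto.
           assert (Hodd : Nat.odd (S m) = false).
           { unfold Nat.odd. apply Bool.negb_false_iff.
             destruct Ds as (Hs & Ms & _), Dt as (Ht & Mt & _).
             destruct (rank_parity F s Hs) as [Ps _], (rank_parity F t Ht) as [Pt _].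
             specialize (Ps Ms). specialize (Pt Mt).
             destruct (Nat.max_spec (rank s) (rank t)) as [[_ E]|[_ E]]; rewrite E in Hm; rewrite <- Hm; auto. }
           rewrite Hodd.
           assert (Hr : forall u, In u (map fst (mulfacs s)) \/ In u (map fst (mulfacs t)) -> (rank u <= m)%nat).
           { destruct Ds as (Hs & Ms & _), Dt as (Ht & Mt & _).
             intros u [Hu|Hu]; apply mulfacs_rank in Hu; destruct Hu as [_ Hu];
               [specialize (Hu Ms)|specialize (Hu Mt)]; lia. }
           apply mul_lt_lexlt; auto.
           ++ intros u [Hu|Hu]; [apply (KB s)|apply (KB t)]; auto.
           ++ intros u v Hu Hv. apply ltn_prec.
              ** destruct Hu as [Hu| ->]; [auto|simpl; lia].
              ** destruct Hv as [Hv| ->]; [auto|simpl; lia].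
Qed.

Lemma addcomps_head F p : nf_pre F p -> exists u r, addcomps p = (1, u) :: r.
Proof. destruct p; intro H; simpl; eauto. apply (nf_add _ _ H). Qed.

(** Both lists are proportional and start with coefficient 1, which forces [c = 1]. *)
Lemma addcomps_proportional F s t c : nf_pre F s -> nf_pre F t -> c <> 0 ->
  (forall u, coef (addcomps s) u = c * coef (addcomps t) u) -> s = t.
Proof.
  intros Hs Ht Hc H. apply (addcomps_inj F); auto.
  assert (Hk : forall p u, nf_pre F p -> (rank p <= Nat.max (rank s) (rank t))%nat ->
             In u (map snd (addcomps p)) -> nf_nonadd F (Nat.max (rank s) (rank t)) u).
  { intros p u Hp Hr Hu. destruct (addcomps_nf _ _ _ Hp Hu). apply addcomps_rank in Hu.
    repeat split; auto; lia. }
  assert (E : addcomps s = map (fun p => (c * fst p, snd p)) (addcomps t)).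
  { apply (proportional (nf_nonadd F (Nat.max (rank s) (rank t)))); auto.
    - apply strict_total_levels.
    - intros u. apply Hk; auto; lia.
    - intros u. apply Hk; auto; lia.
    - now apply (addcomps_decreasing F).
    - now apply (addcomps_decreasing F).
    - intros a u. now apply (addcomps_nonzero F).
    - intros a u. now apply (addcomps_nonzero F). }
  destruct (addcomps_head F s Hs) as (u & r & Es), (addcomps_head F t Ht) as (u' & r' & Et).
  assert (c = 1) by (rewrite Es, Et in E; simpl in E; injection E; intros; lra). subst c.
  rewrite E. rewrite <- (map_id (addcomps t)) at 2. apply map_ext. intros [a v]. simpl. f_equal. ring.
Qed.

Lemma mulfacs_equal F s t : nf_pre F s -> nf_pre F t ->
  (forall u, coef (real_exps (mulfacs s)) u = coef (real_exps (mulfacs t)) u) -> s = t.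
Proof.
  intros Hs Ht H. apply (mulfacs_inj F); auto.
  assert (Hk : forall p u, nf_pre F p -> (rank p <= Nat.max (rank s) (rank t))%nat ->
             In u (map fst (mulfacs p)) -> nf_nonmul F (Nat.max (rank s) (rank t)) u).
  { intros p u Hp Hr Hu. destruct (mulfacs_nf _ _ _ Hp Hu) as (? & ? & ?). apply mulfacs_rank in Hu.
    repeat split; auto; lia. }
  assert (E : real_exps (mulfacs s) = map (fun p => (1 * fst p, snd p)) (real_exps (mulfacs t))).
  { apply (proportional (nf_nonmul F (Nat.max (rank s) (rank t)))); rewrite ?keys_real_exps; auto; try lra.
    - apply strict_total_levels.
    - intros u. apply Hk; auto; lia.
    - intros u. apply Hk; auto; lia.
    - now apply (mulfacs_decreasing F).
    - now apply (mulfacs_decreasing F).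
    - intros a u. now apply (mulfacs_nonzero F).
    - intros a u. now apply (mulfacs_nonzero F).
    - intro u. rewrite H. ring. }
  revert E. generalize (mulfacs s) (mulfacs t). clear.
  induction l as [|[u i] l IH]; intros [|[v j] m] E; try discriminate; auto.
  simpl in E. injection E as E1 -> E2. rewrite Rmult_1_l in E1. apply eq_IZR in E1. subst. f_equal. now apply IH.
Qed.

(** * Triangular independence *)

Fixpoint lsum (val : pre -> R -> R) (l : list (R * pre)) (x : R) : R :=
  match l with
  | [] => 0
  | (a, u) :: r => a * val u x + lsum val r x
  end.

(** An echelon condition, newest entry first: each new member of [cls] has a coordinate at which all
    older entries vanish. Extending the list leaves the older conditions as they are. *)
Fixpoint tri (cls : pre -> Prop) (val : pre -> R -> R) (L : list pre) : Prop :=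
  match L with
  | [] => True
  | u :: r => tri cls val r /\ (cls u -> exists x, val u x <> 0 /\ forall v, In v r -> val v x = 0)
  end.

Lemma lsum_app val l m x : lsum val (l ++ m) x = lsum val l x + lsum val m x.
Proof. induction l as [|[a u] l IH]; simpl; [ring|rewrite IH; ring]. Qed.

Lemma lsum_scale val c l x : lsum val (map (fun p => (c * fst p, snd p)) l) x = c * lsum val l x.
Proof. induction l as [|[a u] l IH]; simpl; [ring|rewrite IH; ring]. Qed.

Lemma coef_app l m u : coef (l ++ m) u = coef l u + coef m u.
Proof. induction l as [|[a v] l IH]; simpl; [ring|rewrite IH; ring]. Qed.

Lemma coef_scale c l u : coef (map (fun p => (c * fst p, snd p)) l) u = c * coef l u.
Proof.
  induction l as [|[a v] l IH]; simpl; [ring|rewrite IH; destruct excluded_middle_informative; ring].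
Qed.

Lemma tri_ext cls val val' L : (forall u x, In u L -> val u x = val' u x) -> tri cls val L -> tri cls val' L.
Proof.
  induction L as [|u L IH]; simpl; auto. intros H [H1 H2]. split; [apply IH; auto|].
  intro Hu. destruct (H2 Hu) as [x [Hx1 Hx2]]. exists x. split.
  - rewrite <- H; auto.
  - intros v Hv. rewrite <- H; auto.
Qed.

Lemma tri_independent (cls : pre -> Prop) val L : tri cls val L ->
  forall l, (forall u, In u (map snd l) -> In u L /\ cls u) ->
  (forall x, lsum val l x = 0) -> forall u, coef l u = 0.
Proof.
  induction L as [|u0 L IH]; simpl; intros HT l Hl H0.
  - destruct l as [|[a u] l]; auto. exfalso. destruct (Hl u); simpl; auto.
  - destruct HT as [HT Hu0].
    set (l' := filter (fun p => if excluded_middle_informative (snd p = u0) then false else true) l).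
    assert (Hl' : forall u, In u (map snd l') -> In u (map snd l) /\ u <> u0).
    { intros u Hu. destruct (in_keys _ _ Hu) as [a Ha]. unfold l' in Ha. apply filter_In in Ha.
      destruct Ha as [Ha Ha']. simpl in Ha'. split.
      - apply in_map_iff. now exists (a, u).
      - destruct excluded_middle_informative; congruence. }
    assert (Hsum : forall x, lsum val l x = coef l u0 * val u0 x + lsum val l' x).
    { intro x. unfold l'. clear. induction l as [|[a u] l IH]; simpl; [ring|]. rewrite IH.
      destruct excluded_middle_informative as [->|]; simpl; ring. }
    assert (Hcoef : forall u, u <> u0 -> coef l u = coef l' u).
    { intros u Hu. unfold l'. clear - Hu. induction l as [|[a v] l IH]; simpl; [ring|]. rewrite IH.
      destruct (excluded_middle_informative (v = u0)) as [->|]; simpl; auto.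
      destruct excluded_middle_informative; [congruence|ring]. }
    assert (Hc : coef l u0 = 0).
    { destruct (classic (cls u0)) as [Hcl|Hcl].
      - destruct (Hu0 Hcl) as [x [Hx1 Hx2]]. specialize (H0 x). rewrite Hsum in H0.
        replace (lsum val l' x) with 0 in H0.
        + rewrite Rplus_0_r in H0. apply Rmult_integral in H0. tauto.
        + assert (Hz : forall u, In u (map snd l') -> val u x = 0).
          { intros u Hu. apply Hl' in Hu. destruct Hu as [Hu Hne].
            apply Hx2. destruct (Hl u Hu) as [[->|] _]; tauto. }
          clear - Hz. induction l' as [|[a u] m IH]; simpl; auto. rewrite <- IH.
          * rewrite Hz by (simpl; auto). ring.
          * intros; apply Hz; simpl; auto.
      - apply coef_out. intro Hu. now apply Hl in Hu. }
    intro u. destruct (classic (u = u0)) as [->|Hu]; auto. rewrite Hcoef by auto.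
    apply IH; auto.
    + intros v Hv. apply Hl' in Hv. destruct Hv as [Hv Hne]. destruct (Hl v Hv) as [[->|] ?]; tauto.
    + intro x. specialize (H0 x). rewrite Hsum, Hc in H0. lra.
Qed.

(** * Generic values *)

Definition cpow (k : comparison) (i : Z) : comparison := if Z.even i then cmul k k else k.

Section Values.

Variable E : Vovs -> Wovs.

Definition value (c : comparison * Vovs) : Wovs := erep Wovs Vovs E (fst c) (snd c).

Definition wsum (f : pre -> Wovs) (l : list (R * pre)) : Wovs :=
  fold_right (fun p acc => vadd (vscal (fst p) (f (snd p))) acc) vzero l.

Definition ksign (a : pre -> comparison * Vovs) (l : list (pre * Z)) : comparison :=
  fold_right (fun p acc => cmul (cpow (fst (a (fst p))) (snd p)) acc) Gt l.

Definition vsum (a : pre -> comparison * Vovs) (l : list (pre * Z)) : Vovs :=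
  fold_right (fun p acc => vadd (vscal (IZR (snd p)) (snd (a (fst p)))) acc) vzero l.

Definition vprod (a : pre -> comparison * Vovs) (l : list (pre * Z)) : comparison * Vovs :=
  (ksign a l, vsum a l).

End Values.

Lemma wsum_ext f g l : (forall u, In u (map snd l) -> f u = g u) -> wsum f l = wsum g l.
Proof.
  induction l as [|[a u] l IH]; simpl; auto. intro H. rewrite IH, (H u) by auto. reflexivity.
Qed.

Lemma vprod_ext a b l : (forall u, In u (map fst l) -> a u = b u) -> vprod a l = vprod b l.
Proof.
  unfold vprod. induction l as [|[u i] l IH]; simpl; auto. intro H.
  assert (E : (ksign a l, vsum a l) = (ksign b l, vsum b l)) by auto.
  injection E as E1 E2. now rewrite E1, E2, (H u) by auto.
Qed.

Lemma wsum_at f l x : fval (wsum f l) x = lsum (fun u => fval (f u)) l x.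
Proof.
  induction l as [|[a u] l IH].
  - apply (@co_zero Wovs x).
  - change (a * fval (f u) x + fval (wsum f l) x = a * fval (f u) x + lsum (fun u => fval (f u)) l x).
    now rewrite IH.
Qed.

Lemma vsum_at a l x : infpart (vsum a l) x = lsum (fun u => infpart (snd (a u))) (real_exps l) x.
Proof.
  induction l as [|[u i] l IH].
  - apply (@co_zero Wovs x).
  - change (IZR i * infpart (snd (a u)) x + infpart (vsum a l) x =
            IZR i * infpart (snd (a u)) x + lsum (fun u => infpart (snd (a u))) (real_exps l) x).
    now rewrite IH.
Qed.

Lemma cmul_neq_Eq k l : k <> Eq -> l <> Eq -> cmul k l <> Eq.
Proof. destruct k, l; simpl; congruence. Qed.

Lemma cpow_neq_Eq k i : k <> Eq -> cpow k i <> Eq.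
Proof. unfold cpow. destruct Z.even; auto. intro. now apply cmul_neq_Eq. Qed.

Lemma ksign_neq_Eq a l : (forall u, In u (map fst l) -> fst (a u) <> Eq) -> ksign a l <> Eq.
Proof.
  induction l as [|[u i] l IH]; simpl; [congruence|]. intro H.
  apply cmul_neq_Eq; auto. apply cpow_neq_Eq. auto.
Qed.

(* [a u] codes the value of [u] in the model as a sign and a logarithm. *)
Record generic (F : R -> Prop) (E : Vovs -> Wovs) (a : pre -> comparison * Vovs) (L : list pre) : Prop := {
  g_expo : expo Wovs Vovs E;
  g_rich : rich E;
  g_one_in : In POne L;
  g_nf : forall u, In u L -> nf_pre F u;
  g_comps : forall p u, In p L -> In u (map snd (addcomps p)) -> In u L;
  g_facs : forall p u, In p L -> In u (map fst (mulfacs p)) -> In u L;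
  g_sign : forall u, In u L -> fst (a u) <> Eq;
  g_one : a POne = (Gt, vzero);
  g_add : forall l, In (PAdd l) L -> value E (a (PAdd l)) = wsum (fun u => value E (a u)) l;
  g_mul : forall l, In (PMul l) L -> a (PMul l) = vprod a l;
  g_tri_add : tri not_additive (fun u => fval (value E (a u))) L;
  g_tri_mul : tri (fun u => not_multiplicative u /\ not_one u) (fun u => infpart (snd (a u))) L }.

Section Generic.

Variables (F : R -> Prop) (E : Vovs -> Wovs) (a : pre -> comparison * Vovs) (L : list pre).
Hypothesis G : generic F E a L.

Lemma generic_addcomps p x : In p L ->
  fval (value E (a p)) x = lsum (fun u => fval (value E (a u))) (addcomps p) x.
Proof.
  intro Hp. destruct p as [i| |l|l]; try (simpl; ring).
  rewrite (g_add _ _ _ _ G) by auto. apply wsum_at.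
Qed.

Lemma generic_mulfacs p x : In p L ->
  infpart (snd (a p)) x = lsum (fun u => infpart (snd (a u))) (real_exps (mulfacs p)) x.
Proof.
  intro Hp. destruct p as [i| |l|l]; try (simpl; ring).
  - rewrite (g_one _ _ _ _ G). apply (@co_zero Wovs x).
  - rewrite (g_mul _ _ _ _ G) by auto. apply vsum_at.
Qed.

(** Meant for a sum [p] not yet listed, whose value its components force: independence turns
    proportional values into proportional coefficients. *)
Lemma addcomps_separated p q c : nf_pre F p -> (forall u, In u (map snd (addcomps p)) -> In u L) ->
  In q L -> c <> 0 ->
  (forall x, lsum (fun u => fval (value E (a u))) (addcomps p) x = c * fval (value E (a q)) x) -> p = q.
Proof.
  intros Hp Hk Hq Hc H. pose proof (g_nf _ _ _ _ G q Hq) as Hq'.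
  apply (addcomps_proportional F p q c); auto. intro u.
  assert (H0 : coef (addcomps p ++ map (fun p => (- c * fst p, snd p)) (addcomps q)) u = 0).
  { eapply tri_independent; [apply (g_tri_add _ _ _ _ G)| |].
    - intros v Hv. rewrite map_app, map_map in Hv. apply in_app_or in Hv. simpl in Hv. destruct Hv as [Hv|Hv].
      + split; auto. now apply (addcomps_nf F p).
      + split; [now apply (g_comps _ _ _ _ G q)|now apply (addcomps_nf F q)].
    - intro x. rewrite lsum_app, lsum_scale, H, <- generic_addcomps by auto. ring. }
  rewrite coef_app, coef_scale in H0. lra.
Qed.

(** The multiplicative counterpart: the infinitesimal parts of the logarithms already determine the
    exponents. *)
Lemma mulfacs_separated p q : nf_pre F p -> (forall u, In u (map fst (mulfacs p)) -> In u L) ->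
  In q L ->
  (forall x, lsum (fun u => infpart (snd (a u))) (real_exps (mulfacs p)) x = infpart (snd (a q)) x) -> p = q.
Proof.
  intros Hp Hk Hq H. pose proof (g_nf _ _ _ _ G q Hq) as Hq'.
  apply (mulfacs_equal F p q); auto. intro u.
  assert (H0 : coef (real_exps (mulfacs p) ++ map (fun p => (-1 * fst p, snd p)) (real_exps (mulfacs q))) u = 0).
  { eapply tri_independent; [apply (g_tri_mul _ _ _ _ G)| |].
    - intros v Hv. rewrite map_app, map_map in Hv. apply in_app_or in Hv. simpl in Hv.
      change (map (fun x => snd x)) with (map (@snd R pre)) in Hv. rewrite !keys_real_exps in Hv.
      destruct Hv as [Hv|Hv].
      + split; auto. now apply (mulfacs_nf F p).
      + split; [now apply (g_facs _ _ _ _ G q)|now apply (mulfacs_nf F q)].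
    - intro x. rewrite lsum_app, lsum_scale, H, <- generic_mulfacs by auto. ring. }
  rewrite coef_app, coef_scale in H0. lra.
Qed.

(** This is [ex_shift], with the two signs absorbed into the factor. *)
Lemma value_nonzero_scal k k' v v' r : k <> Eq -> k' <> Eq ->
  v' = vadd (vscal r vone) v -> exists c, c <> 0 /\ value E (k', v') = vscal c (value E (k, v)).
Proof.
  intros Hk Hk' ->. pose proof (exp_pos r).
  pose proof (ex_shift _ _ _ (g_expo _ _ _ _ G) v r) as HE.
  destruct k, k'; try congruence; unfold value, erep; cbn [fst snd]; rewrite HE;
    [exists (exp r)|exists (- exp r)|exists (- exp r)|exists (exp r)]; (split; [lra|]); vec_eq.
Qed.

Lemma value_neq_zero k v : k <> Eq -> value E (k, v) <> vzero.
Proof.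
  intros Hk H.
  assert (HE := erep_eq _ _ _ (g_expo _ _ _ _ G) k Eq v vzero). apply HE in H. tauto.
Qed.

End Generic.

Lemma generic_injective F E a L p q c : generic F E a L -> In p L -> In q L -> c <> 0 ->
  value E (a p) = vscal c (value E (a q)) -> p = q.
Proof.
  intros G Hp Hq Hc H. apply (addcomps_separated F E a L G p q c); auto.
  - now apply (g_nf _ _ _ _ G).
  - intros u. now apply (g_comps _ _ _ _ G).
  - intro x. rewrite <- (generic_addcomps F E a L G) by auto. rewrite H. reflexivity.
Qed.

Definition assign (a : pre -> comparison * Vovs) (u : pre) (p : comparison * Vovs) (q : pre) :
  comparison * Vovs := if excluded_middle_informative (q = u) then p else a q.

Lemma assign_same a u p : assign a u p u = p.
Proof. unfold assign. destruct excluded_middle_informative; tauto. Qed.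

Lemma assign_other a u p L q : ~ In u L -> In q L -> assign a u p q = a q.
Proof. intros Hu Hq. unfold assign. destruct excluded_middle_informative as [->|]; tauto. Qed.

(** Old values persist because [E'] agrees with [E] at the old logarithms. The last two hypotheses
    place [u] at the head of the triangular systems in which its kind takes part. *)
Lemma generic_extend F E a L E' u p : generic F E a L -> ~ In u L -> nf_pre F u ->
  (forall l, u = PAdd l -> forall v, In v (map snd l) -> In v L) ->
  (forall l, u = PMul l -> forall v, In v (map fst l) -> In v L) ->
  expo Wovs Vovs E' -> rich E' ->
  (forall v, In v (map (fun q => snd (a q)) L) -> E' v = E v) -> fst p <> Eq ->
  (forall l, u = PAdd l -> value E' p = wsum (fun v => value E (a v)) l) ->
  (forall l, u = PMul l -> p = vprod a l) ->
  (not_additive u -> exists x, fval (value E' p) x <> 0 /\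
     forall w, In w (map (fun q => value E (a q)) L) -> fval w x = 0) ->
  (not_multiplicative u -> exists x, infpart (snd p) x <> 0 /\
     forall v, In v (map (fun q => snd (a q)) L) -> infpart v x = 0) ->
  generic F E' (assign a u p) (u :: L).
Proof.
  intros G Hu Hnf HA HM HE HR HEE Hp HpA HpM Hw Hv.
  assert (Hoth : forall q, In q L -> assign a u p q = a q) by (intros; now apply (assign_other a u p L)).
  assert (Hval : forall q, In q L -> value E' (assign a u p q) = value E (a q)).
  { intros q Hq. rewrite Hoth by auto. unfold value, erep.
    rewrite (HEE (snd (a q))) by (apply (in_map (fun q => snd (a q))), Hq). reflexivity. }
  constructor; auto.
  - right. apply (g_one_in _ _ _ _ G).
  - intros v [<-|Hv']; auto. now apply (g_nf _ _ _ _ G).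
  - intros q v [<-|Hq] Hv'; [|right; now apply (g_comps _ _ _ _ G q)].
    destruct u as [i| |l|l]; try (destruct Hv' as [<-|[]]; now left). right. eapply HA; eauto.
  - intros q v [<-|Hq] Hv'; [|right; now apply (g_facs _ _ _ _ G q)].
    destruct u as [i| |l|l]; try (destruct Hv' as [<-|[]]; now left); try destruct Hv'. right. eapply HM; eauto.
  - intros v [<-|Hv']; [now rewrite assign_same|]. rewrite Hoth by auto. now apply (g_sign _ _ _ _ G).
  - rewrite Hoth by apply (g_one_in _ _ _ _ G). apply (g_one _ _ _ _ G).
  - intros l Hl. destruct Hl as [->|Hl].
    + rewrite assign_same, (HpA l eq_refl). apply wsum_ext. intros v Hv'. symmetry. apply Hval. eauto.
    + rewrite Hval, (g_add _ _ _ _ G) by auto. apply wsum_ext. intros v Hv'. symmetry. apply Hval.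
      now apply (g_comps _ _ _ _ G (PAdd l)).
  - intros l Hl. destruct Hl as [->|Hl].
    + rewrite assign_same. transitivity (vprod a l); [auto|]. apply vprod_ext. intros v Hv'. symmetry. apply Hoth. eauto.
    + rewrite Hoth, (g_mul _ _ _ _ G) by auto. apply vprod_ext. intros v Hv'. symmetry. apply Hoth.
      now apply (g_facs _ _ _ _ G (PMul l)).
  - split.
    + eapply tri_ext; [|apply (g_tri_add _ _ _ _ G)]. intros q x Hq. simpl. now rewrite Hval.
    + intro Hc. destruct (Hw Hc) as [x [Hx1 Hx2]]. exists x. rewrite assign_same. split; auto.
      intros q Hq. rewrite Hval by auto. apply Hx2. now apply (in_map (fun q => value E (a q))).
  - split.
    + eapply tri_ext; [|apply (g_tri_mul _ _ _ _ G)]. intros q x Hq. simpl. now rewrite Hoth.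
    + intros [Hc _]. destruct (Hv Hc) as [x [Hx1 Hx2]]. exists x. rewrite assign_same. split; auto.
      intros q Hq. rewrite Hoth by auto. apply Hx2. now apply (in_map (fun q => snd (a q))).
Qed.

Lemma value_at_neq E k v x : k <> Eq -> fval (E v) x <> 0 -> fval (value E (k, v)) x <> 0.
Proof.
  intros Hk H. destruct k; try congruence; unfold value, erep; cbn [fst snd]; auto.
  change (-1 * fval (E v) x <> 0). lra.
Qed.

Lemma zero_log F E a L : generic F E a L -> In vzero (map (fun q => snd (a q)) L).
Proof.
  intro G. apply in_map_iff. exists POne. rewrite (g_one _ _ _ _ G). split; auto.
  apply (g_one_in _ _ _ _ G).
Qed.

Lemma generic_var F E a L i : generic F E a L -> ~ In (PVar i) L ->
  exists E' p, generic F E' (assign a (PVar i) p) (PVar i :: L).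
Proof.
  intros G Hi.
  destruct (below_supp (map snd (map (fun q => snd (a q)) L))) as [m Hm].
  (* A variable is unconstrained: its logarithm is chosen with a fresh coordinate [m], and its value
     is moved afterwards. *)
  set (v := (0, 0, point m 1) : Vovs).
  assert (Hv : infpart v m = 1) by apply point_at.
  assert (HL : forall u, In u (map (fun q => snd (a q)) L) -> infpart u m = 0).
  { intros u Hu. apply Hm; [now apply in_map|lra]. }
  destruct (move_value E v (map (fun q => snd (a q)) L) (map (fun q => value E (a q)) L))
    as (E' & HE & HR & HEE & x & Hx1 & Hx2); try apply G.
  - eapply zero_log; eauto.
  - intros u Hu. right. exists m. rewrite Hv, HL by auto. lra.
  - exists E', (Gt, v). eapply generic_extend; eauto; try discriminate; simpl; auto.
    intros _. exists m. rewrite Hv. split; [lra|auto].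
Qed.

(** The factors force the logarithm [vsum a l], so the value is moved; an old class would make the
    product equal to a listed preterm. *)
Lemma generic_mul F E a L l : generic F E a L -> ~ In (PMul l) L -> nf_pre F (PMul l) ->
  (forall u, In u (map fst l) -> In u L) ->
  exists E' p, generic F E' (assign a (PMul l) p) (PMul l :: L).
Proof.
  intros G Hl Hnf Hk.
  destruct (move_value E (vsum a l) (map (fun q => snd (a q)) L) (map (fun q => value E (a q)) L))
    as (E' & HE & HR & HEE & x & Hx1 & Hx2); try apply G.
  - eapply zero_log; eauto.
  - intros u Hu. apply in_map_iff in Hu. destruct Hu as [q [<- Hq]]. right.
    apply NNPP. intro Hn. apply Hl.
    rewrite (mulfacs_separated F E a L G (PMul l) q); auto.
    intro x. rewrite <- vsum_at. simpl. apply NNPP. intro Hx. apply Hn. exists x. auto.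
  - assert (Hs : ksign a l <> Eq).
    { apply ksign_neq_Eq. intros u Hu. apply (g_sign _ _ _ _ G). auto. }
    exists E', (vprod a l). eapply generic_extend; eauto; try discriminate.
    + intros m H. injection H as ->. auto.
    + intros m H. injection H as ->. auto.
    + intros _. exists x. split; auto. now apply value_at_neq.
    + intros [].
Qed.

Lemma addcomps_NoDup F p : nf_pre F p -> NoDup (map snd (addcomps p)).
Proof.
  intro H. apply (decreasing_NoDup (nf_nonadd F (rank p))).
  - apply strict_total_levels.
  - intros u Hu. destruct (addcomps_nf F p u H Hu). apply addcomps_rank in Hu. repeat split; tauto.
  - now apply (addcomps_decreasing F).
Qed.

(** The summands force the value [w], so its logarithm is moved; an old class would make [w]
    proportional to a listed value, and the sum equal to that preterm. *)
Lemma generic_add F E a L l : generic F E a L -> ~ In (PAdd l) L -> nf_pre F (PAdd l) ->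
  (forall u, In u (map snd l) -> In u L) ->
  exists E' p, generic F E' (assign a (PAdd l) p) (PAdd l :: L).
Proof.
  intros G Hl Hnf Hk.
  set (w := wsum (fun u => value E (a u)) l).
  (* The leading coefficient 1 makes the combination nontrivial; by independence [w] is nonzero and
     has a logarithm. *)
  assert (Hw : w <> vzero).
  { intro H0.
    destruct (nf_add _ _ Hnf) as (_ & _ & _ & u & r & El).
    assert (Hc : coef l u = 1).
    { apply coef_in; [apply (addcomps_NoDup F (PAdd l) Hnf)|]. rewrite El. now left. }
    rewrite (tri_independent _ _ _ (g_tri_add _ _ _ _ G)) in Hc; [lra| |].
    - intros v Hv. split; auto. now apply (addcomps_nf F (PAdd l)).
    - intro x. rewrite <- wsum_at. fold w. rewrite H0. apply (@co_zero Wovs x). }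
  destruct (erep_surj _ _ _ (g_expo _ _ _ _ G) w) as (k & v & Hkv).
  assert (Hs : k <> Eq) by (intros ->; apply Hw; symmetry; exact Hkv).
  destruct (move_log E v (map (fun q => snd (a q)) L))
    as (E' & v' & HE & HR & HEE & Hv' & x & Hx1 & Hx2); try apply G.
  - eapply zero_log; eauto.
  - intros u Hu. apply in_map_iff in Hu. destruct Hu as [q [<- Hq]].
    apply NNPP. intro Hn. apply Hl.
    assert (Hc : exists c, c <> 0 /\ value E (k, v) = vscal c (value E (fst (a q), snd (a q)))).
    { apply (value_nonzero_scal F E a L G) with (r := snd (fst v) - snd (fst (snd (a q)))); auto.
      - now apply (g_sign _ _ _ _ G).
      - assert (H1 : fst (fst v) = fst (fst (snd (a q)))).
        { apply NNPP. intro H. apply Hn. left. auto. }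
        assert (H2 : forall x, infpart v x = infpart (snd (a q)) x).
        { intro x. apply NNPP. intro H. apply Hn. right. exists x. auto. }
        apply co_inj. intro i. rewrite co_add, co_scal. destruct i as [[]|x].
        + change (fst (fst v) = (snd (fst v) - snd (fst (snd (a q)))) * 0 + fst (fst (snd (a q)))).
          rewrite H1. ring.
        + change (snd (fst v) = (snd (fst v) - snd (fst (snd (a q)))) * 1 + snd (fst (snd (a q)))). ring.
        + change (infpart v x = (snd (fst v) - snd (fst (snd (a q)))) * fval (@vzero Wovs) x + infpart (snd (a q)) x).
          rewrite H2. change fval with (@co Wovs). rewrite co_zero. ring. }
    destruct Hc as [c [Hc1 Hc2]]. rewrite <- surjective_pairing in Hc2.
    rewrite (addcomps_separated F E a L G (PAdd l) q c); auto.
    intro x. rewrite <- wsum_at. simpl addcomps. fold w. rewrite <- Hkv.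
    change (erep Wovs Vovs E k v) with (value E (k, v)). rewrite Hc2. reflexivity.
  - exists E', (k, v'). eapply generic_extend; eauto; try discriminate.
    + intros m H. injection H as ->. auto.
    + intros m H. injection H as ->. change (wsum _ m) with w. rewrite <- Hkv.
      unfold value, erep; simpl. now rewrite Hv'.
    + intros [].
Qed.

(** * Building a generic model for given normal forms *)

Lemma generic_init F : generic F exp0 (fun _ => (Gt, vzero)) [POne].
Proof.
  constructor.
  - apply expo_exp0.
  - apply rich_exp0.
  - now left.
  - intros u [<-|[]]. exact I.
  - intros p u [<-|[]]. auto.
  - intros p u [<-|[]] [].
  - discriminate.
  - reflexivity.
  - intros l [H|[]]. discriminate.
  - intros l [H|[]]. discriminate.
  - simpl. split; auto. intros _. exists 0. split; [|intros v []].
    assert (H : fval (exp0 vzero) 0 = 1) by (rewrite (ex_zero _ _ _ expo_exp0); apply point_at).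
    change (fval (exp0 vzero) 0 <> 0). lra.
  - simpl. tauto.
Qed.

(** Subterms are treated before [p]. The arbitrary starting list allows them to be added one after
    another. *)
Lemma generic_reach F p : nf_pre F p -> forall E a L, generic F E a L ->
  exists E' a' L', generic F E' a' L' /\ incl L L' /\ In p L'.
Proof.
  remember (rank p) as n eqn:Hn. revert p Hn.
  induction n as [n IH] using (well_founded_induction lt_wf). intros p -> Hp.
  assert (IHl : forall ks, (forall u, In u ks -> (rank u < rank p)%nat /\ nf_pre F u) ->
     forall E a L, generic F E a L -> exists E' a' L', generic F E' a' L' /\ incl L L' /\ incl ks L').
  { induction ks as [|u ks IHks]; intros Hks E a L G.
    - exists E, a, L. split; auto. split; [apply incl_refl|intros v []].
    - destruct IHks with (E := E) (a := a) (L := L) as (E1 & a1 & L1 & G1 & I1 & K1); auto.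
      { intros; apply Hks; now right. }
      destruct (Hks u (or_introl eq_refl)) as [Hr Hu].
      destruct (IH (rank u) Hr u eq_refl Hu _ _ _ G1) as (E2 & a2 & L2 & G2 & I2 & K2).
      exists E2, a2, L2. split; auto. split; [eapply incl_tran; eauto|].
      intros v [<-|Hv]; auto. }
  assert (Hfin : forall E a L, generic F E a L -> (exists E' q, ~ In p L -> generic F E' (assign a p q) (p :: L)) ->
     exists E' a' L', generic F E' a' L' /\ incl L L' /\ In p L').
  { intros E a L G [E' [q H]]. destruct (classic (In p L)) as [Hi|Hi].
    - exists E, a, L. split; auto. split; [apply incl_refl|auto].
    - exists E', (assign a p q), (p :: L). split; auto. split; [apply incl_tl, incl_refl|now left]. }
  intros E a L G. destruct p as [i| |l|l].
  - apply (Hfin E a L G). destruct (classic (In (PVar i) L)) as [Hi|Hi].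
    (* Dummy witnesses: the variable is already listed. *)
    + exists E, (Gt, vzero). tauto.
    + destruct (generic_var F E a L i G Hi) as (E' & q & H). exists E', q. auto.
  - exists E, a, L. split; auto. split; [apply incl_refl|apply (g_one_in _ _ _ _ G)].
  - destruct (IHl (map snd l)) with (E := E) (a := a) (L := L) as (E1 & a1 & L1 & G1 & I1 & K1); auto.
    { intros u Hu. split; [now apply rank_add_comp|]. now apply (addcomps_nf F (PAdd l)). }
    destruct (Hfin E1 a1 L1 G1) as (E2 & a2 & L2 & G2 & I2 & K2).
    + destruct (classic (In (PAdd l) L1)) as [Hi|Hi].
      * exists E, (Gt, vzero). tauto.
      * destruct (generic_add F E1 a1 L1 l G1 Hi Hp K1) as (E' & q & H). exists E', q. auto.
    + exists E2, a2, L2. split; auto. split; auto. eapply incl_tran; eauto.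
  - destruct (IHl (map fst l)) with (E := E) (a := a) (L := L) as (E1 & a1 & L1 & G1 & I1 & K1); auto.
    { intros u Hu. split; [now apply rank_mul_fac|]. now apply (mulfacs_nf F (PMul l)). }
    destruct (Hfin E1 a1 L1 G1) as (E2 & a2 & L2 & G2 & I2 & K2).
    + destruct (classic (In (PMul l) L1)) as [Hi|Hi].
      * exists E, (Gt, vzero). tauto.
      * destruct (generic_mul F E1 a1 L1 l G1 Hi Hp K1) as (E' & q & H). exists E', q. auto.
    + exists E2, a2, L2. split; auto. split; auto. eapply incl_tran; eauto.
Qed.

(** * Evaluation of normal forms in the model *)

Section Evaluation.

Variables (E : Vovs -> Wovs) (HE : expo Wovs Vovs E).
Let M : structure := exp_struct Wovs Vovs E HE.
Variable env : nat -> Wovs.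

Lemma eval_zpow t k v i : k <> Eq -> i <> 0%Z -> eval M env t = erep Wovs Vovs E k v ->
  eval M env (zpow t i) = erep Wovs Vovs E (cpow k i) (vscal (IZR i) v).
Proof.
  intros Hk Hi Ht. assert (HM : mul_rep M Vovs (erep Wovs Vovs E)) by apply exp_struct_mul_rep.
  assert (Hkk : cmul k k = Gt) by (destruct k; simpl; congruence).
  assert (HkG : cmul Gt k = k) by (destruct k; simpl; congruence).
  (* [pos_pow t 1] is [t] itself, so the induction starts there; the sign is [k] for an odd exponent
     [S n], that is, for even [n]. *)
  assert (Hpow : forall n, eval M env (pos_pow t (S n)) =
            erep Wovs Vovs E (if Nat.even n then k else Gt) (vscal (INR (S n)) v)).
  { induction n as [|n IH].
    - change (eval M env (pos_pow t 1)) with (eval M env t). rewrite Ht. f_equal. change (INR 1) with 1. vec_eq.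
    - change (eval M env (pos_pow t (S (S n)))) with
        (s_mul M (eval M env (pos_pow t (S n))) (eval M env t)).
      rewrite IH, Ht. rewrite (mr_mul _ _ _ HM). f_equal.
      + rewrite Nat.even_succ, <- Nat.negb_even. destruct (Nat.even n); simpl; auto.
      + rewrite (S_INR (S n)). vec_eq. }
  assert (Hpos : forall q, eval M env (pos_pow t (Pos.to_nat q)) =
            erep Wovs Vovs E (cpow k (Zpos q)) (vscal (IZR (Zpos q)) v)).
  { intro q. destruct (Pos2Nat.is_succ q) as [n Hn]. rewrite Hn, Hpow. f_equal.
    - unfold cpow. replace (Z.even (Zpos q)) with (Nat.even (S n)).
      + rewrite Nat.even_succ, <- Nat.negb_even. destruct (Nat.even n); simpl; auto.
      + rewrite <- Hn. destruct q; simpl Z.even.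
        * now rewrite Pos2Nat.inj_xI, Nat.even_succ, <- Nat.negb_even, Nat.even_mul.
        * now rewrite Pos2Nat.inj_xO, Nat.even_mul.
        * reflexivity.
    - rewrite <- Hn, INR_IPR. reflexivity. }
  destruct i as [|q|q]; [congruence|apply Hpos|].
  change (eval M env (zpow t (Zneg q))) with (s_div M (s_one M) (eval M env (pos_pow t (Pos.to_nat q)))).
  rewrite Hpos, (mr_one _ _ _ HM), (mr_div _ _ _ HM). f_equal.
  - unfold cpow. simpl. destruct q; rewrite ?Hkk; auto.
  - change (Zneg q) with (- Zpos q)%Z. rewrite opp_IZR. vec_eq.
Qed.

Lemma eval_add f l : l <> [] -> (forall u, In u (map snd l) -> eval M env (to_term u) = f u) ->
  eval M env (to_term (PAdd l)) = wsum f l.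
Proof.
  destruct l as [|[b u] l]; [congruence|]. intros _ H.
  (* Left parenthesization makes [to_term] an accumulator loop, so the induction has to generalize
     over [acc]. *)
  assert (Hg : forall acc, (forall u, In u (map snd l) -> eval M env (to_term u) = f u) ->
    eval M env ((fix go (acc : term) (r : list (R * pre)) : term :=
             match r with
             | [] => acc
             | (b, v) :: r' => go (Add acc (Scal b (to_term v))) r'
             end) acc l) = vadd (eval M env acc) (wsum f l)).
  { clear H. induction l as [|[c v] l IH]; intros acc H; [symmetry; apply (vadd_zero_r Wovs)|].
    rewrite IH by (intros; apply H; simpl; auto).
    change (eval M env (Add acc (Scal c (to_term v)))) with (vadd (eval M env acc) (vscal c (eval M env (to_term v)))).
    rewrite (H v) by (simpl; auto). apply (vadd_assoc Wovs). }
  cbn [to_term]. rewrite Hg by (intros; apply H; simpl; auto).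
  change (eval M env (Scal b (to_term u))) with (vscal b (eval M env (to_term u))).
  rewrite (H u) by (simpl; auto). reflexivity.
Qed.

Lemma eval_mul a l : l <> [] ->
  (forall u i, In (u, i) l -> i <> 0%Z /\ fst (a u) <> Eq /\ eval M env (to_term u) = value E (a u)) ->
  eval M env (to_term (PMul l)) = value E (vprod a l).
Proof.
  assert (HM : mul_rep M Vovs (erep Wovs Vovs E)) by apply exp_struct_mul_rep.
  destruct l as [|[u i] l]; [congruence|]. intros _ H.
  assert (Hz : forall u i, i <> 0%Z /\ fst (a u) <> Eq /\ eval M env (to_term u) = value E (a u) ->
     eval M env (zpow (to_term u) i) = erep Wovs Vovs E (cpow (fst (a u)) i) (vscal (IZR i) (snd (a u)))).
  { intros v j (H1 & H2 & H3). now apply eval_zpow. }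
  assert (Hg : forall acc k v,
    (forall u i, In (u, i) l -> i <> 0%Z /\ fst (a u) <> Eq /\ eval M env (to_term u) = value E (a u)) ->
    eval M env acc = erep Wovs Vovs E k v ->
    eval M env ((fix go (acc : term) (r : list (pre * Z)) : term :=
             match r with
             | [] => acc
             | (v, j) :: r' => go (Mul acc (zpow (to_term v) j)) r'
             end) acc l) = erep Wovs Vovs E (cmul k (ksign a l)) (vadd v (vsum a l))).
  { clear H. induction l as [|[c j] l IH]; intros acc k v H Hacc.
    - rewrite Hacc. f_equal; [now destruct k|symmetry; apply (vadd_zero_r Vovs)].
    - rewrite (IH _ (cmul k (cpow (fst (a c)) j)) (vadd v (vscal (IZR j) (snd (a c))))).
      + f_equal; [|apply (vadd_assoc Vovs)].
        change (ksign a ((c, j) :: l)) with (cmul (cpow (fst (a c)) j) (ksign a l)).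
        destruct k, (cpow (fst (a c)) j), (ksign a l); reflexivity.
      + intros; apply H; simpl; auto.
      + change (eval M env (Mul acc (zpow (to_term c) j))) with
          (s_mul M (eval M env acc) (eval M env (zpow (to_term c) j))).
        rewrite Hacc, Hz by (apply H; simpl; auto). apply (mr_mul _ _ _ HM). }
  cbn [to_term]. erewrite Hg; [| |apply Hz; apply H; simpl; auto].
  - reflexivity.
  - intros; apply H; simpl; auto.
Qed.

End Evaluation.

Lemma generic_eval F E a L (G : generic F E a L) p : In p L ->
  eval (exp_struct Wovs Vovs E (g_expo _ _ _ _ G)) (fun n => value E (a (PVar n))) (to_term p) = value E (a p).
Proof.
  remember (rank p) as n eqn:Hn. revert p Hn.
  induction n as [n IH] using (well_founded_induction lt_wf). intros p -> Hp.
  pose proof (g_nf _ _ _ _ G p Hp) as Hnf.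
  destruct p as [i| |l|l].
  - reflexivity.
  - rewrite (g_one _ _ _ _ G). unfold value; simpl. symmetry. apply (ex_zero _ _ _ (g_expo _ _ _ _ G)).
  - rewrite (g_add _ _ _ _ G) by auto. apply eval_add.
    + apply nf_add in Hnf. destruct Hnf as [H _]. destruct l; simpl in H; [lia|congruence].
    + intros u Hu. eapply IH; eauto using rank_add_comp. now apply (g_comps _ _ _ _ G (PAdd l)).
  - rewrite (g_mul _ _ _ _ G) by auto. apply eval_mul.
    + apply nf_mul in Hnf. destruct Hnf as [[H|(u & i & -> & _)] _]; [|congruence].
      destruct l; simpl in H; [lia|congruence].
    + intros u i Hu. assert (Hk : In u (map fst l)) by (apply (in_map fst) in Hu; exact Hu).
      assert (HuL : In u L) by (now apply (g_facs _ _ _ _ G (PMul l))).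
      split; [now apply (nf_mul _ _ Hnf) in Hu|]. split; [now apply (g_sign _ _ _ _ G)|].
      eapply IH; eauto using rank_mul_fac.
Qed.

Lemma generic_value_nonzero F E a L p : generic F E a L -> In p L -> value E (a p) <> vzero.
Proof.
  intros G Hp. rewrite (surjective_pairing (a p)). apply (value_neq_zero F E a L G).
  now apply (g_sign _ _ _ _ G).
Qed.

Theorem theorem8p3 (F : R -> Prop) (HF : is_subfield F) (s t : term) :
  nf_term F s -> nf_term F t -> T_proves F (FEq s t) -> s = t.
Proof.
  assert (Hex : forall p q, nf_pre F p -> nf_pre F q ->
            exists E a L, generic F E a L /\ In p L /\ In q L).
  { intros p q Hp Hq.
    destruct (generic_reach F p Hp _ _ _ (generic_init F)) as (E1 & a1 & L1 & G1 & _ & K1).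
    (* The list built for [p] is extended, so one model serves both preterms. *)
    destruct (generic_reach F q Hq _ _ _ G1) as (E2 & a2 & L2 & G2 & I2 & K2).
    exists E2, a2, L2. auto. }
  assert (Hzero : forall b q, b <> 0 -> nf_pre F q ->
            ~ T_proves F (FEq Zero (Scal b (to_term q)))).
  { intros b q Hb Hq H. destruct (Hex q q Hq Hq) as (E & a & L & G & K & _).
    specialize (H _ (exp_struct_model F _ _ E (g_expo _ _ _ _ G)) (fun n => value E (a (PVar n)))).
    cbn [sat eval] in H. rewrite (generic_eval F E a L G q K) in H.
    apply (generic_value_nonzero F E a L q G K). apply (vscal_eq0 Wovs b); auto. }
  intros [->|(b & p & _ & Hb & Hp & ->)] [->|(c & q & _ & Hc & Hq & ->)] H; auto.
  - exfalso. eapply Hzero; eauto.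
  - exfalso. apply (Hzero b p Hb Hp). intros M HM env. symmetry. now apply H.
  - destruct (Hex p q Hp Hq) as (E & a & L & G & Kp & Kq).
    specialize (H _ (exp_struct_model F _ _ E (g_expo _ _ _ _ G)) (fun n => value E (a (PVar n)))).
    cbn [sat eval] in H. rewrite (generic_eval F E a L G p Kp), (generic_eval F E a L G q Kq) in H.
    change (vscal b (value E (a p)) = vscal c (value E (a q))) in H.
    assert (p = q).
    { apply (generic_injective F E a L p q (/ b * c)); auto.
      - apply Rmult_integral_contrapositive_currified; auto. now apply Rinv_neq_0_compat.
      - replace (value E (a p)) with (vscal (/ b) (vscal b (value E (a p)))) by vec_eq.
        rewrite H. vec_eq. }
    (* The preterms coincide, and [b - c] annihilates their common nonzero value. *)
    subst q. f_equal. apply Rminus_diag_uniq. apply NNPP. intro Hbc.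
    apply (generic_value_nonzero F E a L p G Kp). apply (vscal_eq0 Wovs (b - c)); auto.
    replace (vscal (b - c) (value E (a p))) with (vsub (vscal b (value E (a p))) (vscal c (value E (a p)))) by vec_eq.
    now apply vsub_zero.
Qed.
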